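(* Let $A,B,C,P,Q\in\mathbb{C}^{N\times N}$ be pairwise commuting matrices such that $B+sI$ and $C+sI$ are invertible for every integer $s\ge0$, and such that $P$ and $Q$ are positive stable. Then for $x>0$, $$\int_0^x t^{P-I}(x-t)^{Q-I}\,{}_1F_2(A;B,C;t)\,dt=x^{P+Q-I}\,\mathbf{B}(P,Q)\,{}_2F_3(A,P;B,C,P+Q;x).$$
   Context: $I$ is the $N\times N$ identity matrix. A matrix is positive stable if all its eigenvalues have positive real part. For $M\in\mathbb{C}^{N\times N}$, $(M)_0=I$, $(M)_k=M(M+I)\cdots(M+(k-1)I)$ for $k\ge1$; for $t>0$, $t^M=\exp(M\ln t)$. The beta matrix function is $\mathbf{B}(P,Q)=\int_0^1t^{P-I}(1-t)^{Q-I}\,dt$ for $P,Q$ positive stable. For commuting matrices, ${}_1F_2(A;B,C;z)=\sum_{k\ge0}\frac{z^k}{k!}(A)_k[(B)_k]^{-1}[(C)_k]^{-1}$ and ${}_2F_3(A,P;B,C,D;z)=\sum_{k\ge0}\frac{z^k}{k!}(A)_k(P)_k[(B)_k]^{-1}[(C)_k]^{-1}[(D)_k]^{-1}$. *)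

(* Defs.v *)
From HB Require Import structures.
From mathcomp Require Import all_boot all_order all_algebra.
From mathcomp Require Import complex.
From mathcomp Require Import all_classical all_reals all_analysis.

Set Implicit Arguments.
Unset Strict Implicit.
Unset Printing Implicit Defensive.

Import Order.TTheory GRing.Theory Num.Theory.
Import numFieldNormedType.Exports.

Local Open Scope classical_set_scope.
Local Open Scope ring_scope.
Local Open Scope complex_scope.

(* The usual topology of the complex numbers, i.e. the one of the modulus;
   matrices over R[i] then inherit the library's entrywise topology. *)
#[non_forgetful_inheritance]
HB.instance Definition _ (R : realType) := NormedModule.copy R[i] R[i]^o.

Section MatrixFunctions.
Context {R : realType} {N : nat}.
Implicit Types (M A B C D P Q : 'M[R[i]]_N) (F : R -> 'M[R[i]]_N).

Definition positive_stable M : Prop :=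
  forall a : R[i], eigenvalue M a -> 0 < complex.Re a.

Definition mxpoch M (k : nat) : 'M[R[i]]_N :=
  \prod_(0 <= j < k) (M + (j%:R)%:M).

Definition mxexp M : 'M[R[i]]_N :=
  limn (series (fun k : nat => (k`!%:R)^-1 *: M ^+ k)).

(* t^M, meaningful for t > 0 *)
Definition mxrpow (t : R) M : 'M[R[i]]_N := mxexp ((ln t)%:C *: M).

(* Lebesgue integral over ]a, b[ of a matrix-valued function, taken on the
   real and imaginary parts of each entry. *)
Definition mxintegrable (a b : R) F : Prop :=
  forall i j,
    (@lebesgue_measure R).-integrable `]a, b[
      (fun t => (complex.Re (F t i j))%:E) /\
    (@lebesgue_measure R).-integrable `]a, b[
      (fun t => (complex.Im (F t i j))%:E).

Definition mxintegral (a b : R) F : 'M[R[i]]_N :=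
  \matrix_(i, j)
    ((\int[@lebesgue_measure R]_(t in `]a, b[) complex.Re (F t i j)) +i*
     (\int[@lebesgue_measure R]_(t in `]a, b[) complex.Im (F t i j))).

Definition mxbeta_integrand P Q (t : R) : 'M[R[i]]_N :=
  mxrpow t (P - 1%:M) *m mxrpow (1 - t) (Q - 1%:M).

Definition mxbeta P Q : 'M[R[i]]_N := mxintegral 0 1 (mxbeta_integrand P Q).

Definition hyp1F2_term A B C (z : R[i]) (k : nat) : 'M[R[i]]_N :=
  (z ^+ k / k`!%:R) *:
    (mxpoch A k *m invmx (mxpoch B k) *m invmx (mxpoch C k)).

Definition hyp1F2 A B C (z : R[i]) : 'M[R[i]]_N :=
  limn (series (hyp1F2_term A B C z)).

Definition hyp2F3_term A P B C D (z : R[i]) (k : nat) : 'M[R[i]]_N :=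
  (z ^+ k / k`!%:R) *:
    (mxpoch A k *m mxpoch P k *m invmx (mxpoch B k) *m invmx (mxpoch C k)
       *m invmx (mxpoch D k)).

Definition hyp2F3 A P B C D (z : R[i]) : 'M[R[i]]_N :=
  limn (series (hyp2F3_term A P B C D z)).

End MatrixFunctions.

(* Main.v *)
Require Import Defs.
From mathcomp Require Import all_boot all_order all_algebra.
From mathcomp Require Import complex.
From mathcomp Require Import all_classical all_reals all_analysis.
From mathcomp Require Import measurable_realfun ring lra.

Set Implicit Arguments.
Unset Strict Implicit.
Unset Printing Implicit Defensive.

Import Order.TTheory GRing.Theory Num.Theory.
Import numFieldNormedType.Exports.

Local Open Scope classical_set_scope.
Local Open Scope ring_scope.
Local Open Scope complex_scope.

(** The two sides agree term by term. Expanding the series under the integral sign,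
    the substitution t = x u turns the k-th term into
      x^(P+Q-I) x^k / k! B(P + kI, Q) (A)_k (B)_k^-1 (C)_k^-1,
    and the recursion B(P + I, Q) (P + Q) = B(P, Q) P, iterated in [mxbeta_addn],
    gives B(P + kI, Q) = B(P, Q) (P)_k (P + Q)_k^-1. The recursion itself,
    [mxbeta_rec], is the vanishing of the integral of the derivative of
    t^P (1-t)^Q over ]0, 1[.

    The analytic input is the behaviour of t^P at 0. For P positive stable there
    are constants with |t^P| <= M t^d on ]0, 1] and d > 0 ([mxrpow_decay]), proved
    without Jordan form: by Cayley-Hamilton a product of factors P - r, Re r > 0,
    vanishes, and peeling off one factor at a time reduces the claim to a scalar
    equation y' = r y + g with decaying g, settled by an energy estimate
    ([ode_decay]). Three things follow: the integrand of the beta function is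
    dominated by t^(p-1) + (1-t)^(q-1); the boundary terms t^P (1-t)^Q vanish; and
    P + Q + sI is invertible, since a nonzero K with K (P + Q) = 0 would satisfy
    K t^P t^Q = K for all t > 0 whereas t^P t^Q tends to 0.

    The matrix exponential and both hypergeometric series are sums of t^k / k! c_k
    with |c_k| <= D K^k. For the latter this holds because the inverses (B + kI)^-1,
    hence the quotients (A + kI)(B + kI)^-1 = I + (A - B)(B + kI)^-1, are bounded
    in k. Such series converge, can be differentiated term by term and have partial
    sums that are uniformly bounded for bounded t, which is the domination needed
    to exchange sum and integral in [mxint_beta_expsum]. *)

(** * Lifting real linear notions to complex matrices *)

Section Lift.
Context {R : realType} {T : Type}.
Implicit Types (L : (T -> R) -> R -> Prop) (f g : T -> R).

(** Convergence to a limit, differentiability with a given derivative and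
    integrability with a given integral are all relations of this kind between a
    function and a value. *)
Definition linear_relation L : Prop :=
  L (fun=> 0) 0 /\ forall (a : R) f g v w,
    L f v -> L g w -> L (fun t => a * f t + g t) (a * v + w).

Definition clift L (f : T -> R[i]) (z : R[i]) : Prop :=
  L (fun t => complex.Re (f t)) (complex.Re z) /\
  L (fun t => complex.Im (f t)) (complex.Im z).

(** Imposed on the real and imaginary parts of all entries, a linear relation is
    stable under multiplication by constant matrices on either side: one proof
    serves for limits, derivatives and integrals. *)
Definition mxlift N L (F : T -> 'M[R[i]]_N) (V : 'M[R[i]]_N) : Prop :=
  forall i j, clift L (fun t => F t i j) (V i j).

Lemma cReD (x y : R[i]) : complex.Re (x + y) = complex.Re x + complex.Re y.
Proof. by case: x y => ? ? [? ?]. Qed.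

Lemma cImD (x y : R[i]) : complex.Im (x + y) = complex.Im x + complex.Im y.
Proof. by case: x y => ? ? [? ?]. Qed.

Lemma cReM (x y : R[i]) : complex.Re (x * y) =
  complex.Re x * complex.Re y - complex.Im x * complex.Im y.
Proof. by case: x y => ? ? [? ?]. Qed.

Lemma cImM (x y : R[i]) : complex.Im (x * y) =
  complex.Re x * complex.Im y + complex.Im x * complex.Re y.
Proof. by case: x y => ? ? [? ?]. Qed.

Lemma cRe_sum I (r : seq I) (P : pred I) (F : I -> R[i]) :
  complex.Re (\sum_(i <- r | P i) F i) = \sum_(i <- r | P i) complex.Re (F i).
Proof. exact: (big_morph (@complex.Re R) cReD). Qed.

Lemma cIm_sum I (r : seq I) (P : pred I) (F : I -> R[i]) :
  complex.Im (\sum_(i <- r | P i) F i) = \sum_(i <- r | P i) complex.Im (F i).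
Proof. exact: (big_morph (@complex.Im R) cImD). Qed.

Section Linear.
Variable L : (T -> R) -> R -> Prop.
Hypothesis Llin : linear_relation L.

Lemma lin_eq f g v w : L f v -> f =1 g -> v = w -> L g w.
Proof. by move=> h /funext <- <-. Qed.

Lemma linZ a f v : L f v -> L (fun t => a * f t) (a * v).
Proof.
move=> fv; apply: (lin_eq (Llin.2 a _ _ _ _ fv Llin.1)); last by rewrite addr0.
by move=> t; rewrite addr0.
Qed.

Lemma linD f g v w : L f v -> L g w -> L (fun t => f t + g t) (v + w).
Proof.
move=> fv gw; apply: (lin_eq (Llin.2 1 _ _ _ _ fv gw)); last by rewrite mul1r.
by move=> t; rewrite mul1r.
Qed.

Lemma cliftD (f g : T -> R[i]) z w : clift L f z -> clift L g w ->
  clift L (fun t => f t + g t) (z + w).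
Proof.
move=> [f1 f2] [g1 g2]; split.
  by apply: (lin_eq (linD f1 g1)) => [t|]; rewrite cReD.
by apply: (lin_eq (linD f2 g2)) => [t|]; rewrite cImD.
Qed.

Lemma cliftZ c (f : T -> R[i]) z : clift L f z ->
  clift L (fun t => c * f t) (c * z).
Proof.
move=> [f1 f2]; split.
  apply: (lin_eq (linD (linZ (complex.Re c) f1) (linZ (- complex.Im c) f2))).
    by move=> t; rewrite cReM mulNr.
  by rewrite cReM mulNr.
apply: (lin_eq (linD (linZ (complex.Re c) f2) (linZ (complex.Im c) f1))).
  by move=> t; rewrite cImM.
by rewrite cImM.
Qed.

Lemma clift0 : clift L (fun=> 0) 0.
Proof. by split; apply: Llin.1. Qed.

Lemma clift_sum I (r : seq I) (F : I -> T -> R[i]) (v : I -> R[i]) :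
  (forall i, clift L (F i) (v i)) ->
  clift L (fun t => \sum_(i <- r) F i t) (\sum_(i <- r) v i).
Proof.
move=> FV; elim: r => [|i r IH].
  rewrite big_nil; under [X in clift _ X _]funext do rewrite big_nil.
  exact: clift0.
rewrite big_cons; under [X in clift _ X _]funext do rewrite big_cons.
exact: cliftD.
Qed.

Variable N : nat.
Implicit Types F G : T -> 'M[R[i]]_N.

Lemma mxlift_eq F G V W : mxlift L F V -> F =1 G -> V = W -> mxlift L G W.
Proof. by move=> FV /funext <- <-. Qed.

Lemma mxliftD F G V W : mxlift L F V -> mxlift L G W ->
  mxlift L (fun t => F t + G t) (V + W).
Proof.
move=> FV GW i j; rewrite mxE; under [X in clift _ X _]funext do rewrite mxE.
exact: cliftD.
Qed.

Lemma mxliftMl A F V : mxlift L F V -> mxlift L (fun t => A * F t) (A * V).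
Proof.
move=> FV i j; rewrite mxE; under [X in clift _ X _]funext do rewrite mxE.
by apply: clift_sum => k; apply: cliftZ.
Qed.

Lemma mxliftMr A F V : mxlift L F V -> mxlift L (fun t => F t * A) (V * A).
Proof.
move=> FV i j; rewrite mxE; under [X in clift _ X _]funext do rewrite mxE.
apply: clift_sum => k; rewrite mulrC.
under [X in clift _ X _]funext do rewrite mulrC.
exact: cliftZ.
Qed.

Lemma mxliftB F G V W : mxlift L F V -> mxlift L G W ->
  mxlift L (fun t => F t - G t) (V - W).
Proof.
move=> FV GW; apply: (mxlift_eq (mxliftD FV (mxliftMl (-1) GW))) => [t|];
  by rewrite mulN1r.
Qed.

Lemma mxlift_sum I (r : seq I) (F : I -> T -> 'M[R[i]]_N) (V : I -> 'M[R[i]]_N) :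
  (forall i, mxlift L (F i) (V i)) ->
  mxlift L (fun t => \sum_(i <- r) F i t) (\sum_(i <- r) V i).
Proof.
move=> FV i j; rewrite summxE; under [X in clift _ X _]funext do rewrite summxE.
by apply: clift_sum => k; apply: FV.
Qed.

End Linear.
End Lift.

(** * Convergence of sequences of complex matrices *)

Section MatrixLimit.
Context {R : realType} {N : nat}.
Implicit Types (u v : nat -> 'M[R[i]]_N) (A B V W : 'M[R[i]]_N).

Definition rcvgn (f : nat -> R) (l : R) : Prop := f @ \oo --> l.

Definition mxcvgn u V : Prop := mxlift rcvgn u V.

Lemma rcvgn_linear : linear_relation rcvgn.
Proof.
split; first exact: cvg_cst.
by move=> a f g v w fv gw; apply: cvgD gw; apply: cvgMr.
Qed.

(** Balls of matrices are products of balls of R[i], and |z| is at most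
    |Re z| + |Im z|. *)
Lemma mxcvgnP u V : mxcvgn u V -> u @ \oo --> V.
Proof.
move=> uV; apply/cvg_ballP => e; rewrite ltcE /= => /andP[/eqP ime re].
have e2 : 0 < complex.Re e / 2 by rewrite divr_gt0.
have H i j : \forall n \near \oo, ball (V i j) e (u n i j).
  have [/cvgrPdist_lt/(_ _ e2) h1 /cvgrPdist_lt/(_ _ e2) h2] := uV i j.
  near=> n.
  have a1 : `|complex.Re (V i j) - complex.Re (u n i j)| < complex.Re e / 2.
    by near: n.
  have a2 : `|complex.Im (V i j) - complex.Im (u n i j)| < complex.Re e / 2.
    by near: n.
  rewrite -ball_normE /ball_ /=.
  move: a1 a2; case: (V i j) (u n i j) => a b [c d] /= a1 a2.
  have -> : (a +i* b) - (c +i* d) =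
      (real_complex R) (a - c) + Complex 0 1 * (real_complex R) (b - d).
    by simpc.
  apply: le_lt_trans (ler_normD _ _) _.
  rewrite normrM !normc_def /= !expr0n /= expr1n add0r sqrtr1 mul1r !addr0.
  rewrite !sqrtr_sqr.
  rewrite -rmorphD /= (complexE e) ime mulr0 addr0 ltcR.
  lra.
near=> n; split; first by rewrite ltcE /= ime eqxx.
move=> i j.
have : forall ij : 'I_N * 'I_N, ball (V ij.1 ij.2) e (u n ij.1 ij.2).
  by near: n; apply: filter_forall => -[i' j']; apply: H.
by move=> /(_ (i, j)).
Unshelve. all: by end_near. Qed.

Lemma mxcvgn_lim u V : mxcvgn u V -> limn u = V.
Proof. by move=> /mxcvgnP; apply: cvg_lim; apply: norm_hausdorff. Qed.

Lemma mxcvgn_unique u V W : mxcvgn u V -> mxcvgn u W -> V = W.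
Proof. by move=> /mxcvgn_lim <- /mxcvgn_lim. Qed.

(** Index 0 is skipped because partial sums are empty there. *)
Lemma mxcvgn_near u v V : (forall n, u n.+1 = v n.+1) -> mxcvgn u V ->
  mxcvgn v V.
Proof.
move=> uv uV i j; have [h1 h2] := uV i j; split.
  apply: cvg_trans h1; apply: near_eq_cvg; near=> n.
  by rewrite -(prednK (_ : 0 < n)%N) ?uv//; near: n; exists 1%N.
apply: cvg_trans h2; apply: near_eq_cvg; near=> n.
by rewrite -(prednK (_ : 0 < n)%N) ?uv//; near: n; exists 1%N.
Unshelve. all: by end_near. Qed.

End MatrixLimit.

(** * A submultiplicative norm *)

Section Norm.
Context {R : realType} {N : nat}.
Implicit Types (M A B : 'M[R[i]]_N) (z w : R[i]).

(** Equivalent to the modulus and also submultiplicative, but directly comparable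
    with the real and imaginary parts. *)
Definition cabs1 z : R := `|complex.Re z| + `|complex.Im z|.

Lemma cabs1_ge0 z : 0 <= cabs1 z.
Proof. exact: addr_ge0. Qed.

Lemma cabs1_eq0 z : cabs1 z = 0 -> z = 0.
Proof.
move=> /eqP; rewrite paddr_eq0// !normr_eq0 => /andP[/eqP a /eqP b].
by case: z a b => ? ? /= -> ->.
Qed.

Lemma cabs1D z w : cabs1 (z + w) <= cabs1 z + cabs1 w.
Proof. by rewrite /cabs1 cReD cImD addrACA lerD// ler_normD. Qed.

Lemma cabs1M z w : cabs1 (z * w) <= cabs1 z * cabs1 w.
Proof.
rewrite /cabs1 cReM cImM.
have := ler_normB (complex.Re z * complex.Re w) (complex.Im z * complex.Im w).
have := ler_normD (complex.Re z * complex.Im w) (complex.Im z * complex.Re w).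
rewrite !normrM; lra.
Qed.

Lemma cabs1_sum I (r : seq I) (F : I -> R[i]) :
  cabs1 (\sum_(i <- r) F i) <= \sum_(i <- r) cabs1 (F i).
Proof.
elim: r => [|i r IH]; first by rewrite !big_nil /cabs1 /= normr0 addr0.
by rewrite !big_cons; apply: le_trans (cabs1D _ _) _; rewrite lerD2l.
Qed.

Definition mxn M : R := \sum_i \sum_j cabs1 (M i j).

Lemma mxn_ge0 M : 0 <= mxn M.
Proof. by do 2 apply: sumr_ge0 => ? _; exact: cabs1_ge0. Qed.

Lemma mxnD A B : mxn (A + B) <= mxn A + mxn B.
Proof.
rewrite -big_split ler_sum//= => i _; rewrite -big_split ler_sum//= => j _.
by rewrite mxE cabs1D.
Qed.

Lemma cabs1_mxn M i j : cabs1 (M i j) <= mxn M.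
Proof.
rewrite /mxn (bigD1 i)//= (bigD1 j)//= -addrA lerDl addr_ge0//.
  by apply: sumr_ge0 => ? _; exact: cabs1_ge0.
by do 2 apply: sumr_ge0 => ? _; exact: cabs1_ge0.
Qed.

Lemma Re_mxn M i j : `|complex.Re (M i j)| <= mxn M.
Proof. by apply: le_trans (cabs1_mxn M i j); rewrite lerDl. Qed.

Lemma Im_mxn M i j : `|complex.Im (M i j)| <= mxn M.
Proof. by apply: le_trans (cabs1_mxn M i j); rewrite lerDr. Qed.

Lemma mxn_eq0 M : mxn M = 0 -> M = 0.
Proof.
move=> M0; apply/matrixP => i j; rewrite mxE; apply: cabs1_eq0.
by apply/eqP; rewrite eq_le cabs1_ge0 andbT -M0 cabs1_mxn.
Qed.

Lemma mxnM A B : mxn (A * B) <= mxn A * mxn B.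
Proof.
have h i j : cabs1 ((A * B) i j) <= \sum_k cabs1 (A i k) * cabs1 (B k j).
  by rewrite mxE; apply: le_trans (cabs1_sum _ _) _; apply: ler_sum => k _;
    exact: cabs1M.
rewrite {1}/mxn /mxn mulr_suml ler_sum// => i _.
apply: le_trans (ler_sum _ (fun j _ => h i j)) _.
rewrite exchange_big /= mulr_suml ler_sum// => k _.
rewrite -mulr_sumr ler_wpM2l ?cabs1_ge0//.
rewrite [leRHS](bigD1 k)//= lerDl.
by do 2 apply: sumr_ge0 => ? _; exact: cabs1_ge0.
Qed.

Lemma mxn_sum I (r : seq I) (F : I -> 'M[R[i]]_N) :
  mxn (\sum_(i <- r) F i) <= \sum_(i <- r) mxn (F i).
Proof.
elim: r => [|i r IH].
  rewrite !big_nil /mxn big1// => i _; rewrite big1// => j _.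
  by rewrite mxE /cabs1 /= normr0 addr0.
by rewrite !big_cons; apply: le_trans (mxnD _ _) _; rewrite lerD2l.
Qed.

Lemma mxnZ (r : R) M : mxn (r%:C *: M) = `|r| * mxn M.
Proof.
rewrite /mxn mulr_sumr; apply: eq_bigr => i _; rewrite mulr_sumr.
apply: eq_bigr => j _; rewrite mxE /cabs1 cReM cImM /= !mul0r subr0 addr0.
by rewrite !normrM mulrDr.
Qed.

Lemma mxnN M : mxn (- M) = mxn M.
Proof.
have -> : - M = (-1)%:C *: M by rewrite rmorphN1 scaleN1r.
by rewrite mxnZ normrN1 mul1r.
Qed.

Lemma mxnX M k : mxn (M ^+ k) <= mxn 1 * mxn M ^+ k.
Proof.
elim: k => [|k IH]; first by rewrite !expr0 mulr1.
rewrite !exprSr mulrA; apply: le_trans (mxnM _ _) _.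
by rewrite ler_wpM2r ?mxn_ge0.
Qed.

End Norm.

(** * Series of exponential type *)

(** The matrix exponential and the hypergeometric series all have the form
    of the sum of the t^k/k! c_k with c_k of at most geometric growth, so that
    their entries are everywhere convergent power series. *)
Section ExpType.
Context {R : realType} {N : nat}.
Implicit Types (c : nat -> 'M[R[i]]_N) (a : nat -> R) (t D K : R).

Definition geom_bounded c := exists D K, 0 <= K /\ forall k, mxn (c k) <= D * K ^+ k.

Definition expterm c t (k : nat) : 'M[R[i]]_N :=
  (t ^+ k / k`!%:R)%:C *: c k.

Definition expsum c t : 'M[R[i]]_N := limn (series (expterm c t)).

(** Domination by D times the exponential series at K |t|. *)
Lemma is_cvg_pseries_fact a D K t : 0 <= K ->
  (forall k, `|a k| <= D * K ^+ k) -> cvgn (pseries (fun k => a k / k`!%:R) t).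
Proof.
move=> K0 aDK; apply: normed_cvg.
apply: (@series_le_cvg _ _ (fun k => D * exp_coeff (K * `|t|) k)) => [k|k|k|].
- exact: normr_ge0.
- rewrite /exp_coeff /= mulr_ge0//; last first.
    by rewrite divr_ge0// exprn_ge0// mulr_ge0.
  have := aDK 0; rewrite expr0 mulr1; apply: le_trans; exact: normr_ge0.
- rewrite /exp_coeff /= !normrM normfV normrX (ger0_norm (ler0n _ _)).
  rewrite exprMn [leRHS](_ : _ = D * K ^+ k / k`!%:R * `|t| ^+ k); last by ring.
  by rewrite ler_wpM2r ?exprn_ge0// ler_wpM2r ?invr_ge0.
- rewrite (_ : series _ = (fun n => D * series (exp_coeff (K * `|t|)) n)).
    by apply: is_cvgMr; exact: is_cvg_series_exp_coeff.
  by apply/funext => n; rewrite /series /= mulr_sumr.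
Qed.

Lemma Re_expterm c t i j n : complex.Re (series (expterm c t) n i j) =
  pseries (fun k => complex.Re (c k i j) / k`!%:R) t n.
Proof.
rewrite /pseries /series /= summxE cRe_sum; apply: eq_bigr => k _.
by rewrite mxE cReM /=; ring.
Qed.

Lemma Im_expterm c t i j n : complex.Im (series (expterm c t) n i j) =
  pseries (fun k => complex.Im (c k i j) / k`!%:R) t n.
Proof.
rewrite /pseries /series /= summxE cIm_sum; apply: eq_bigr => k _.
by rewrite mxE cImM /=; ring.
Qed.

Section Bounded.
Variable c : nat -> 'M[R[i]]_N.
Hypothesis cb : geom_bounded c.

Lemma is_cvg_Re_pseries i j t :
  cvgn (pseries (fun k => complex.Re (c k i j) / k`!%:R) t).
Proof.
have [D [K [K0 h]]] := cb.
apply: (is_cvg_pseries_fact (a := fun k => complex.Re (c k i j)) K0) => k.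
exact: le_trans (Re_mxn _ _ _) (h k).
Qed.

Lemma is_cvg_Im_pseries i j t :
  cvgn (pseries (fun k => complex.Im (c k i j) / k`!%:R) t).
Proof.
have [D [K [K0 h]]] := cb.
apply: (is_cvg_pseries_fact (a := fun k => complex.Im (c k i j)) K0) => k.
exact: le_trans (Im_mxn _ _ _) (h k).
Qed.

Lemma mxcvgn_expsum t : mxcvgn (series (expterm c t)) (expsum c t).
Proof.
pose V := \matrix_(i, j)
  Complex (limn (pseries (fun k => complex.Re (c k i j) / k`!%:R) t))
          (limn (pseries (fun k => complex.Im (c k i j) / k`!%:R) t)).
have h : mxcvgn (series (expterm c t)) V.
  move=> i j; rewrite mxE; split => /=.
    under [X in rcvgn X _]funext do rewrite Re_expterm.
    exact: is_cvg_Re_pseries.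
  under [X in rcvgn X _]funext do rewrite Im_expterm.
  exact: is_cvg_Im_pseries.
by rewrite /expsum (mxcvgn_lim h).
Qed.

Lemma Re_expsum t i j : complex.Re (expsum c t i j) =
  limn (pseries (fun k => complex.Re (c k i j) / k`!%:R) t).
Proof.
apply/esym/cvg_lim => //; have [h _] := mxcvgn_expsum t i j.
by move: h; under [X in rcvgn X _]funext do rewrite Re_expterm.
Qed.

Lemma Im_expsum t i j : complex.Im (expsum c t i j) =
  limn (pseries (fun k => complex.Im (c k i j) / k`!%:R) t).
Proof.
apply/esym/cvg_lim => //; have [_ h] := mxcvgn_expsum t i j.
by move: h; under [X in rcvgn X _]funext do rewrite Im_expterm.
Qed.

Lemma geom_bounded_shift : geom_bounded (fun k => c k.+1).
Proof.
have [D [K [K0 h]]] := cb; exists (D * K), K; split=> // k.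
by rewrite -mulrA -exprS; exact: h.
Qed.

(** The bound is uniform in n and in t, hence the domination needed to integrate
    such a series term by term. *)
Lemma expterm_series_bounded (r : R) : 0 <= r ->
  exists C, forall t n, `|t| <= r -> mxn (series (expterm c t) n) <= C.
Proof.
have [D [K [K0 h]]] := cb => r0.
have D0 : 0 <= D by have := h 0; rewrite expr0 mulr1; apply: le_trans; exact: mxn_ge0.
exists (D * expR (K * r)) => t n tr.
apply: le_trans (_ : D * series (exp_coeff (K * r)) n <= _); last first.
  rewrite ler_wpM2l//; apply: nondecreasing_cvgn_le.
    apply: nondecreasing_series => k _ _; rewrite divr_ge0// exprn_ge0//.
    exact: mulr_ge0.
  exact: is_cvg_series_exp_coeff.
rewrite /series /= mulr_sumr; apply: le_trans (mxn_sum _ _) _.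
apply: ler_sum => k _; rewrite mxnZ normrM normfV normrX (ger0_norm (ler0n _ _)).
rewrite /exp_coeff /= exprMn.
rewrite [leRHS](_ : _ = r ^+ k / k`!%:R * (D * K ^+ k)); last by ring.
apply: ler_pM => //; rewrite ?mxn_ge0 ?divr_ge0 ?exprn_ge0//.
by rewrite ler_wpM2r ?invr_ge0// lerXn2r// nnegrE.
Qed.

End Bounded.

Definition rderive (t : R) (f : R -> R) (d : R) : Prop := is_derive t 1 f d.

Lemma rderive_linear t : linear_relation (rderive t).
Proof.
split; first exact: is_derive_cst.
move=> a f g v w fv gw; apply: is_deriveD => //.
exact: is_deriveZ.
Qed.

Lemma pseries_diffs_fact a :
  pseries_diffs (fun k => a k / k`!%:R) = (fun k => a k.+1 / k`!%:R :> R).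
Proof.
apply/funext => k; rewrite /pseries_diffs factS natrM; field.
by rewrite nat1r !pnatr_eq0 -lt0n fact_gt0.
Qed.

Lemma is_derive_pseries_fact a D K t : 0 <= K ->
  (forall k, `|a k| <= D * K ^+ k) ->
  is_derive t 1 (fun s => limn (pseries (fun k => a k / k`!%:R) s))
                (limn (pseries (fun k => a k.+1 / k`!%:R) t)).
Proof.
move=> K0 aDK.
have aDK1 k : `|a k.+1| <= D * K * K ^+ k by rewrite -mulrA -exprS.
have aDK2 k : `|a k.+2| <= D * K * K * K ^+ k by rewrite -mulrA -exprS.
have h := @pseries_diffs_fact a; have h' := @pseries_diffs_fact (a \o S).
have lt1 : `|t| < `|(`|t| + 1)| by rewrite [ltRHS]ger0_norm ?addr_ge0// ltrDl.
rewrite -h; apply: pseries_snd_diffs lt1; rewrite ?h ?h'.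
- exact: is_cvg_pseries_fact aDK.
- exact: is_cvg_pseries_fact aDK1.
- exact: is_cvg_pseries_fact aDK2.
Qed.

Lemma rderive_expsum c t : geom_bounded c ->
  mxlift (rderive t) (expsum c) (expsum (fun k => c k.+1) t).
Proof.
move=> cb; have cb1 := geom_bounded_shift cb; have [D [K [K0 cDK]]] := cb.
move=> i j; split; rewrite /rderive.
- rewrite Re_expsum//; under [X in is_derive _ _ X]funext do rewrite Re_expsum//.
  apply: (@is_derive_pseries_fact (fun k => complex.Re (c k i j)) D K) => // k.
  exact: le_trans (Re_mxn _ _ _) (cDK k).
- rewrite Im_expsum//; under [X in is_derive _ _ X]funext do rewrite Im_expsum//.
  apply: (@is_derive_pseries_fact (fun k => complex.Im (c k i j)) D K) => // k.
  exact: le_trans (Im_mxn _ _ _) (cDK k).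
Qed.

End ExpType.

(** * Differential calculus of matrix functions *)

Section MatrixDerivative.
Context {R : realType} {N : nat}.
Implicit Types (F G : R -> 'M[R[i]]_N) (V W : 'M[R[i]]_N) (t : R).

Definition mxderive t F V : Prop := mxlift (rderive t) F V.

Lemma cderiveM t (f g : R -> R[i]) z w :
  clift (rderive t) f z -> clift (rderive t) g w ->
  clift (rderive t) (fun s => f s * g s) (z * g t + f t * w).
Proof.
move=> [f1 f2] [g1 g2]; rewrite /rderive in f1 f2 g1 g2 *; split.
- under [X in is_derive _ _ X]funext do rewrite cReM.
  apply: is_derive_eq; rewrite cReD !cReM /= /GRing.scale /=; ring.
- under [X in is_derive _ _ X]funext do rewrite cImM.
  apply: is_derive_eq; rewrite cImD !cImM /= /GRing.scale /=; ring.
Qed.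

Lemma mxderiveM t F G V W : mxderive t F V -> mxderive t G W ->
  mxderive t (fun s => F s * G s) (V * G t + F t * W).
Proof.
move=> FV GW i j; rewrite !mxE -big_split /=.
under [X in clift _ X _]funext do rewrite mxE.
by apply: (clift_sum (rderive_linear t)) => k; exact: cderiveM.
Qed.

Lemma mxderive_comp t F V (g : R -> R) (d : R) : is_derive t 1 g d ->
  mxderive (g t) F V -> mxderive t (fun s => F (g s)) (d%:C *: V).
Proof.
move=> gd FV i j; have [h1 h2] := FV i j; rewrite mxE; split.
  rewrite cReM /= mul0r subr0 mulrC; exact: (is_derive1_comp h1 gd).
rewrite cImM /= mul0r addr0 mulrC; exact: (is_derive1_comp h2 gd).
Qed.

Lemma mxderive0_cst F : (forall t, mxderive t F 0) -> forall s t, F s = F t.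
Proof.
move=> F0 s t; apply/matrixP => i j; apply/eqP; rewrite eq_complex.
apply/andP; split; apply/eqP.
  apply: (@is_derive_0_is_cst _ (fun x => complex.Re (F x i j))) => x.
  by have [] := F0 x i j; rewrite mxE.
apply: (@is_derive_0_is_cst _ (fun x => complex.Im (F x i j))) => x.
by have [] := F0 x i j; rewrite mxE.
Qed.

End MatrixDerivative.

(** * The matrix exponential and real powers *)

Section MatrixExp.
Context {R : realType} {N : nat}.
Implicit Types (M A B : 'M[R[i]]_N) (s t u : R).

Lemma mxscalerAl (c : R[i]) A B : c *: (A * B) = c *: A * B.
Proof. exact: scalemxAl. Qed.

Lemma mxscalerAr (c : R[i]) A B : c *: (A * B) = A * (c *: B).
Proof. exact: scalemxAr. Qed.

Lemma mxexprZn (c : R[i]) A k : (c *: A) ^+ k = c ^+ k *: A ^+ k.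
Proof.
elim: k => [|k IH]; first by rewrite !expr0 scale1r.
by rewrite !exprS IH -mxscalerAl -mxscalerAr scalerA.
Qed.

Lemma geom_bounded_expr M : geom_bounded (fun k => M ^+ k).
Proof.
exists (mxn (1 : 'M[R[i]]_N)), (mxn M).
by split=> [|k]; rewrite ?mxn_ge0 ?mxnX.
Qed.

Lemma mxexpZ M t : mxexp (t%:C *: M) = expsum (fun k => M ^+ k) t.
Proof.
have e : (fun k => k`!%:R^-1 *: (t%:C *: M) ^+ k) = expterm (fun k => M ^+ k) t.
  apply/funext => k; rewrite /expterm mxexprZn scalerA; congr (_ *: _).
  by rewrite rmorphM rmorphXn fmorphV rmorph_nat mulrC.
by rewrite /mxexp e.
Qed.

Lemma mxcvgn_mxexp M t :
  mxcvgn (series (expterm (fun k => M ^+ k) t)) (mxexp (t%:C *: M)).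
Proof. by rewrite mxexpZ; exact/mxcvgn_expsum/geom_bounded_expr. Qed.

Lemma mxderive_mxexp M t :
  mxderive t (fun s => mxexp (s%:C *: M)) (mxexp (t%:C *: M) * M).
Proof.
apply: (mxlift_eq (rderive_expsum t (geom_bounded_expr M))) => [s|].
  by rewrite mxexpZ.
apply: (mxcvgn_unique (mxcvgn_expsum (geom_bounded_shift (geom_bounded_expr M)) t)).
apply: (mxlift_eq (mxliftMr rcvgn_linear M (mxcvgn_mxexp M t))) => // n.
rewrite /series /= mulr_suml; apply: eq_bigr => k _.
by rewrite /expterm -mxscalerAl -exprSr.
Qed.

Lemma mxexp0 : mxexp (0 : 'M[R[i]]_N) = 1.
Proof.
have := mxcvgn_mxexp (0 : 'M[R[i]]_N) 0; rewrite scaler0 => h.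
apply: (mxcvgn_unique h); apply: (mxcvgn_near (u := fun=> 1)); last first.
  by move=> i j; split; exact: cvg_cst.
move=> n; rewrite /series /= big_nat_recl//= big1 => [|k _].
  by rewrite addr0 /expterm expr0 fact0 divr1 scale1r.
by rewrite /expterm expr0n /= mul0r scale0r.
Qed.

Lemma mxexp_comm A B : GRing.comm A B -> GRing.comm A (mxexp B).
Proof.
move=> AB; have h := mxcvgn_mxexp B 1; rewrite rmorph1 scale1r in h.
apply: mxcvgn_unique (mxliftMl rcvgn_linear A h) _.
apply: (mxlift_eq (mxliftMr rcvgn_linear A h)) => // n.
rewrite /series /= mulr_suml mulr_sumr; apply: eq_bigr => k _.
by rewrite /expterm -mxscalerAl -mxscalerAr; congr (_ *: _); exact/esym/commrX.
Qed.

Lemma commZ (c : R[i]) A B : GRing.comm A B -> GRing.comm A (c *: B).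
Proof. by move=> AB; rewrite /GRing.comm -mxscalerAr AB mxscalerAl. Qed.

(** The function s |-> e^(sA) e^(sB) e^(-s(A+B)) has derivative zero, so that its
    value at 1 is its value at 0. The instances (A, B) and (-(A+B), 0) of this
    give the functional equation without multiplying series. *)
Lemma mxexpD A B : GRing.comm A B -> mxexp (A + B) = mxexp A * mxexp B.
Proof.
have key (X Y : 'M[R[i]]_N) : GRing.comm X Y -> mxexp X * mxexp Y * mxexp (- (X + Y)) = 1.
  move=> XY; pose E M s := mxexp (s%:C *: M).
  pose F s := E X s * E Y s * E (- (X + Y)) s.
  have ringid (x y ex ey ez : 'M[R[i]]_N) : x * ey = ey * x ->
      (x + y) * ez = ez * (x + y) ->
      (ex * x * ey + ex * (ey * y)) * ez + ex * ey * (ez * - (x + y)) = 0.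
    move=> xey xyez; rewrite mulrN -xyez -(mulrA ex) xey -mulrDr -mulrDr.
    by rewrite mulrN !mulrA subrr.
  have F0 t : mxderive t F 0.
    have d := mxderiveM (mxderiveM (mxderive_mxexp X t) (mxderive_mxexp Y t))
                (mxderive_mxexp (- (X + Y)) t).
    apply: (mxlift_eq d) => //; rewrite -!/(E _ _).
    have c1 : GRing.comm X (E Y t) by exact/mxexp_comm/commZ.
    have c2 : GRing.comm (X + Y) (E (- (X + Y)) t).
      by apply/mxexp_comm/commZ/commrN.
    move: (E X t) (E Y t) (E _ t) c1 c2 => ex ey ez c1 c2; exact: ringid.
  have := mxderive0_cst F0 1 0; rewrite /F /E rmorph1 rmorph0 !scale1r !scale0r.
  by rewrite mxexp0 !mulr1.
move=> AB; have h := key _ _ AB.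
have h' : mxexp (- (A + B)) * mxexp (A + B) = 1.
  have := key (- (A + B)) 0 (commr0 _).
  by rewrite mxexp0 mulr1 addr0 opprK.
have inverse_unique (x y z : 'M[R[i]]_N) : x * y = 1 -> y * z = 1 -> z = x.
  by move=> xy yz; rewrite -(mul1r z) -xy -mulrA yz mulr1.
exact: inverse_unique h h'.
Qed.

Lemma mxexp_scalar s : mxexp (s%:C%:M : 'M[R[i]]_N) = (expR s)%:C%:M.
Proof.
have h := mxcvgn_mxexp (1 : 'M[R[i]]_N) s; rewrite -[s%:C%:M]scalemx1.
apply: (mxcvgn_unique h); rewrite -scalemx1.
have c : clift rcvgn (fun n => (series (exp_coeff s) n)%:C) (expR s)%:C.
  by split; [exact: is_cvg_series_exp_coeff|exact: cvg_cst].
move=> i j; rewrite mxE mulrC.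
suff -> : (fun n => series (expterm (fun k => 1 ^+ k) s) n i j) =
    (fun n => (1 : 'M[R[i]]_N) i j * (series (exp_coeff s) n)%:C).
  exact: cliftZ rcvgn_linear _ _ _ c.
apply/funext => n; rewrite /series /= summxE rmorph_sum mulr_sumr.
by apply: eq_bigr => k _; rewrite /expterm expr1n mxE mulrC.
Qed.

Lemma mxrpowM t u M : 0 < t -> 0 < u ->
  mxrpow (t * u) M = mxrpow t M * mxrpow u M.
Proof.
move=> t0 u0; rewrite /mxrpow lnM ?posrE// rmorphD scalerDl.
by apply: mxexpD; exact/commZ/commr_sym/commZ.
Qed.

Lemma mxrpowD t A B : GRing.comm A B ->
  mxrpow t (A + B) = mxrpow t A * mxrpow t B.
Proof.
move=> AB; rewrite /mxrpow scalerDr mxexpD//.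
exact/commZ/commr_sym/commZ/commr_sym.
Qed.

Lemma mxrpow_comm t A B : GRing.comm A B -> GRing.comm A (mxrpow t B).
Proof. by move=> AB; exact/mxexp_comm/commZ. Qed.

Lemma mxrpow_nat t k : 0 < t ->
  mxrpow t (k%:R%:M : 'M[R[i]]_N) = (t ^+ k)%:C%:M.
Proof.
move=> t0; rewrite /mxrpow scale_scalar_mx -(rmorph_nat (real_complex R)).
by rewrite -rmorphM mxexp_scalar expRM_natr lnK// posrE.
Qed.

Lemma mxrpow_addn t M k : 0 < t ->
  mxrpow t (M + k%:R%:M) = (t ^+ k)%:C *: mxrpow t M.
Proof.
move=> t0; rewrite mxrpowD ?mxrpow_nat//; last exact: comm_mx_scalar.
by rewrite -[_ * _]/(_ *m _) mul_mx_scalar.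
Qed.

Lemma mxrpow_sub1 t M : 0 < t -> mxrpow t (M - 1%:M) = (t^-1)%:C *: mxrpow t M.
Proof.
move=> t0; rewrite -{2}(subrK 1%:M M) (mxrpow_addn _ 1)// scalerA -rmorphM.
by rewrite expr1 mulVf ?gt_eqF// scale1r.
Qed.

Lemma mxderive_mxrpow t M : 0 < t ->
  mxderive t (fun s => mxrpow s M) ((t^-1)%:C *: (mxrpow t M * M)).
Proof.
move=> t0; have := mxderive_mxexp M (ln t).
exact: (mxderive_comp (is_derive1_ln t0)).
Qed.

End MatrixExp.

(** * Decay of t^P at 0 for a positive stable P *)

Section Decay.
Context {R : realType}.

(** The energy method: with h = |y|^2, a suitable constant K and a = Re l, the
    function s |-> e^(-as) (h(s) - K e^(2es)) is nondecreasing and is nonpositive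
    at 0. *)
Lemma ode_decay (l : R[i]) (y g : R -> R[i]) (C d e : R) :
  0 < complex.Re l -> 0 < e -> e <= d -> 4 * e <= complex.Re l ->
  (forall s, clift (rderive s) y (l * y s + g s)) ->
  (forall s, s <= 0 -> cabs1 (g s) <= C * expR (d * s)) ->
  exists L, 0 <= L /\ forall s, s <= 0 -> cabs1 (y s) <= L * expR (e * s).
Proof.
set a := complex.Re l => a0 e0 ed ea dy gC.
pose b := complex.Im l.
pose p s := complex.Re (y s); pose q s := complex.Im (y s).
pose g1 s := complex.Re (g s); pose g2 s := complex.Im (g s).
pose h s := p s ^+ 2 + q s ^+ 2.
(* The first term makes psi' nonnegative, the second makes psi 0 nonpositive. *)
pose K := 2 * C ^+ 2 / a ^+ 2 + h 0.
have dp (s : R) : is_derive s 1 p (a * p s - b * q s + g1 s).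
  by have [+ _] := dy s; rewrite cReD cReM.
have dq (s : R) : is_derive s 1 q (a * q s + b * p s + g2 s).
  by have [_ +] := dy s; rewrite cImD cImM.
pose psi s := expR (- a * s) * (h s - K * expR (2 * e * s)).
pose dpsi s := expR (- a * s) * (a * h s + 2 * (p s * g1 s + q s * g2 s)
                                 + K * (a - 2 * e) * expR (2 * e * s)).
have dP (s : R) : is_derive s 1 psi (dpsi s).
  have dE (k : R) : is_derive s 1 (fun s : R => expR (k * s)) (k * expR (k * s)).
    have d1 : is_derive s 1 (fun s : R => k * s) k.
      by apply: is_derive_eq; rewrite /GRing.scale /= mulr1.
    have := is_derive1_comp (is_derive_expR (k * s)) d1.
    by rewrite mulrC.
  rewrite /psi /dpsi /h; apply: is_derive_eq.
  by rewrite /GRing.scale /=; ring.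
have h0 s : 0 <= h s by rewrite addr_ge0// sqr_ge0.
have Ca0 : 0 <= 2 * C ^+ 2 / a ^+ 2.
  by apply: divr_ge0; rewrite ?sqr_ge0// mulr_ge0// sqr_ge0.
have K0 : 0 <= K by exact: addr_ge0.
have C0 : 0 <= C.
  have := gC 0 (lexx _); rewrite mulr0 expR0 mulr1; apply: le_trans.
  exact: cabs1_ge0.
have dpsi0 s : s <= 0 -> 0 <= dpsi s.
  move=> s0; rewrite /dpsi mulr_ge0 ?expR_ge0//.
  have E2 : expR (2 * e * s) = expR (e * s) ^+ 2.
    by rewrite -expRM_natl mulrA.
  have gE : g1 s ^+ 2 + g2 s ^+ 2 <= C ^+ 2 * expR (2 * e * s).
    apply: le_trans (_ : (`|g1 s| + `|g2 s|) ^+ 2 <= _).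
      rewrite sqrrD !real_normK ?num_real//.
      have : 0 <= `|g1 s| * `|g2 s| by exact: mulr_ge0.
      lra.
    rewrite E2 -exprMn ler_sqr ?nnegrE ?addr_ge0//; last first.
      by rewrite mulr_ge0 ?expR_ge0.
    apply: le_trans (gC s s0) _; rewrite ler_wpM2l// ler_expR.
    by rewrite ler_wnM2r.
  (* The forcing term is absorbed by completing the squares. *)
  have sq : 0 <= a * h s + 2 * (p s * g1 s + q s * g2 s)
                 + (g1 s ^+ 2 + g2 s ^+ 2) / a.
    rewrite [leRHS](_ : _ = ((a * p s + g1 s) ^+ 2 + (a * q s + g2 s) ^+ 2) / a).
      by rewrite divr_ge0 ?addr_ge0 ?sqr_ge0// ltW.
    by rewrite /h; field; rewrite gt_eqF.
  apply: le_trans sq _; rewrite lerD2l.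
  have Ka : C ^+ 2 / a <= K * (a - 2 * e).
    have a2 : a / 2 <= a - 2 * e by lra.
    apply: le_trans (_ : K * (a / 2) <= _); last by rewrite ler_wpM2l.
    rewrite /K mulrDl (_ : 2 * C ^+ 2 / a ^+ 2 * (a / 2) = C ^+ 2 / a).
      by rewrite lerDl mulr_ge0// divr_ge0// ltW.
    by field; rewrite gt_eqF.
  apply: le_trans (_ : C ^+ 2 / a * expR (2 * e * s) <= _); last first.
    by rewrite ler_wpM2r ?expR_ge0.
  by rewrite mulrAC ler_wpM2r// invr_ge0 ltW.
have hK s : s <= 0 -> h s <= K * expR (2 * e * s).
  move=> s0.
  have : psi s <= psi 0.
    apply: (@ger0_derive1_ndecr _ psi s 0) => //.
    - move=> x; rewrite in_itv/= => /andP[_ /ltW x0].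
      by rewrite derive1E; have [_ ->] := dP x; exact: dpsi0.
    - apply: derivable_within_continuous => x _; by have [] := dP x.
  rewrite {2}/psi !mulr0 expR0 mul1r mulr1 {2}/K opprD addrCA subrr addr0.
  move=> /le_trans -/(_ 0); rewrite oppr_le0 Ca0.
  by move=> /(_ isT); rewrite /psi pmulr_rle0 ?expR_gt0// subr_le0.
have [k [k0 hk]] : exists k, 0 <= k /\
    forall s, s <= 0 -> h s <= k * expR (2 * e * s) by exists K.
(* (|p| + |q|)^2 <= 2 h and 2 k <= (1 + k)^2. *)
exists (1 + k); split; first by rewrite addr_ge0.
move=> s s0; rewrite -ler_sqr ?nnegrE ?cabs1_ge0 ?mulr_ge0 ?expR_ge0 ?addr_ge0//.
apply: le_trans (_ : 2 * h s <= _).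
  rewrite /cabs1 -/(p s) -/(q s) sqrrD !real_normK ?num_real//.
  have : 0 <= (`|p s| - `|q s|) ^+ 2 by exact: sqr_ge0.
  rewrite sqrrB !real_normK ?num_real// /h; lra.
apply: le_trans (_ : 2 * (k * expR (2 * e * s)) <= _).
  by rewrite ler_wpM2l// hk.
have -> : expR (2 * e * s) = expR (e * s) ^+ 2 by rewrite -expRM_natl mulrA.
rewrite exprMn mulrA ler_wpM2r ?sqr_ge0//.
have := sqr_ge0 k; rewrite sqrrD; lra.
Qed.

Variable N : nat.
Implicit Types (M X P Q : 'M[R[i]]_N).

(** By induction on the roots: if the product of the M - r, times X, vanishes
    then Y(s) = e^(sM) X solves Y' = r Y + e^(sM) (M - r) X for the first root
    r, and the induction hypothesis applies to the forcing term. *)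
Lemma mxexp_decay M X (rs : seq R[i]) :
  (forall r, r \in rs -> 0 < complex.Re r) ->
  (\prod_(r <- rs) (M - r%:M)) * X = 0 ->
  exists d C, [/\ 0 < d, 0 <= C & forall s : R, s <= 0 ->
    mxn (mxexp (s%:C *: M) * X) <= C * expR (d * s)].
Proof.
elim: rs X => [|r rs IH] X rs0 MX.
  exists 1, 0; split => // s _; move: MX; rewrite big_nil mul1r => ->.
  by rewrite mulr0 mul0r /mxn big1// => i _; rewrite big1// => j _;
    rewrite mxE /cabs1 /= normr0 addr0.
have c : GRing.comm (M - r%:M) (\prod_(r <- rs) (M - r%:M)).
  apply: commr_prod => z _; apply: commrB; last exact: comm_mx_scalar.
  by apply/commr_sym; apply: commrB => //; exact: comm_mx_scalar.
have [||d [C [d0 C0 dC]]] := IH ((M - r%:M) * X).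
- by move=> z zrs; apply: rs0; rewrite inE zrs orbT.
- by move: MX; rewrite big_cons mulrA c.
have r0 : 0 < complex.Re r by apply: rs0; rewrite mem_head.
pose e := Num.min d (complex.Re r / 4).
have e0 : 0 < e by rewrite lt_min d0 divr_gt0.
have ed : e <= d by rewrite ge_min lexx.
have er : 4 * e <= complex.Re r.
  by have : e <= complex.Re r / 4 by [rewrite ge_min lexx orbT]; lra.
pose Y s := mxexp (s%:C *: M) * X.
pose G s := mxexp (s%:C *: M) * ((M - r%:M) * X).
have dY s : mxderive s Y (r *: Y s + G s).
  apply: (mxlift_eq (mxliftMr (rderive_linear s) X (mxderive_mxexp M s))) => //.
  rewrite /Y /G mulrBl mulrBr -!mulrA addrCA -[r%:M * X]/(r%:M *m X).
  by rewrite mul_scalar_mx -mxscalerAr subrr addr0.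
have bd i j : exists L, 0 <= L /\
    forall s, s <= 0 -> cabs1 (Y s i j) <= L * expR (e * s).
  apply: (@ode_decay r _ (fun s => G s i j) C d) => // s.
    by have := dY s i j; rewrite mxE [X in X + _]mxE.
  by move=> s0; apply: le_trans (cabs1_mxn _ _ _) (dC s s0).
have [L L0] : exists L : 'I_N -> 'I_N -> R, forall i j, 0 <= L i j /\
    forall s, s <= 0 -> cabs1 (Y s i j) <= L i j * expR (e * s).
  have [f fP] := choice (fun ij : 'I_N * 'I_N => bd ij.1 ij.2).
  by exists (fun i j => f (i, j)) => i j; exact: fP (i, j).
exists e, (\sum_i \sum_j L i j); split => // [|s s0].
  by do 2 apply: sumr_ge0 => ? _; exact: (L0 _ _).1.
rewrite mulr_suml ler_sum// => i _; rewrite mulr_suml ler_sum// => j _.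
exact: (L0 i j).2.
Qed.

(** Cayley-Hamilton, the characteristic polynomial being split over R[i]. *)
Lemma char_poly_prod_eq0 M : exists rs : seq R[i],
  (forall r, r \in rs -> eigenvalue M r) /\ \prod_(r <- rs) (M - r%:M) = 0.
Proof.
have [rs rsE] := closed_field_poly_normal (char_poly M).
move: rsE; rewrite (monicP (char_poly_monic M)) scale1r => rsE.
exists rs; split=> [r rrs|]; first by rewrite eigenvalue_root_char rsE root_prod_XsubC.
case: N M rsE => [|n] M rsE; first by apply/matrixP => -[].
have := Cayley_Hamilton M; rewrite rsE rmorph_prod /= => <-.
by apply: eq_bigr => r _; rewrite rmorphB /= horner_mx_X horner_mx_C.
Qed.

(** With t = e^s, the roots of the characteristic polynomial of P provide the
    product that annihilates X = 1 in the decay estimate. *)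
Lemma mxrpow_decay P : positive_stable P -> exists d C, [/\ 0 < d, 0 <= C &
  forall t : R, 0 < t <= 1 -> mxn (mxrpow t P) <= C * t `^ d].
Proof.
move=> Ppos; have [rs [rsP rs0]] := char_poly_prod_eq0 P.
have [||d [C [d0 C0 h]]] := @mxexp_decay P 1 rs.
- by move=> r /rsP; exact: Ppos.
- by rewrite rs0 mul0r.
exists d, C; split => // t /andP[t0 t1].
by have := h (ln t) (ln_le0 t1); rewrite mulr1 /powR gt_eqF.
Qed.

(** Otherwise some K <> 0 has K (P + Q) = 0, so K t^P t^Q = K for all t > 0,
    whereas t^P t^Q tends to 0 with t. *)
Lemma positive_stableD_unit P Q : GRing.comm P Q ->
  positive_stable P -> positive_stable Q -> P + Q \in unitmx.
Proof.
move=> PQ /mxrpow_decay[d [C [d0 C0 hP]]] /mxrpow_decay[d' [C' [d'0 C'0 hQ]]].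
rewrite -row_free_unit -kermx_eq0; apply/eqP; set K := kermx _.
have K0 : K * (P + Q) = 0 by exact: mulmx_ker.
have KE t : K * mxrpow t (P + Q) = K.
  apply: mxcvgn_unique (mxliftMl rcvgn_linear K (mxcvgn_mxexp _ _)) _.
  apply: (mxcvgn_near (u := fun=> K)) => [n|]; last first.
    by move=> i j; split; exact: cvg_cst.
  rewrite /series /= big_nat_recl//= mulrDr [X in _ + X](_ : _ = 0).
    by rewrite addr0 /expterm !expr0 fact0 divr1 rmorph1 scale1r mulr1.
  rewrite mulr_sumr big1// => k _.
  by rewrite /expterm -mxscalerAr (exprS (P + Q)) mulrA K0 mul0r scaler0.
have bd t : 0 < t <= 1 -> mxn K <= mxn K * (C * C') * t `^ (d + d').
  move=> t01; rewrite -{1}(KE t) mxrpowD//.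
  apply: le_trans (mxnM _ _) _; rewrite -mulrA ler_wpM2l ?mxn_ge0//.
  apply: le_trans (mxnM _ _) _.
  rewrite powRD; last by rewrite gt_eqF// addr_gt0.
  rewrite mulrACA; apply: ler_pM; rewrite ?mxn_ge0//; [exact: hP|exact: hQ].
apply: mxn_eq0; apply/eqP; rewrite eq_le mxn_ge0 andbT.
have h : mxn K * (C * C') * t `^ (d + d') @[t --> 0^'+] --> mxn K * (C * C') * 0.
  by apply: cvgMr; apply: powR_cvg0; rewrite addr_gt0.
rewrite mulr0 in h; rewrite -(cvg_lim _ h)//.
apply: limr_ge; first by apply: cvgP h.
near=> t; apply: bd; apply/andP; split; first by near: t; exact: nbhs_right_gt.
by near: t; exact: nbhs_right_le.
Unshelve. all: by end_near. Qed.

End Decay.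

(** * Integration over open intervals *)

Section OpenInterval.
Context {R : realType}.
Implicit Types (a b : R) (f F : R -> R).
Let mu := @lebesgue_measure R.

Definition rint a b f (v : R) : Prop :=
  mu.-integrable `]a, b[ (EFin \o f) /\ \int[mu]_(t in `]a, b[) f t = v.

Lemma rint_linear a b : linear_relation (rint a b).
Proof.
have mI : measurable (`]a, b[ : set R) by exact: measurable_itv.
split.
  split; first exact: integrable0.
  by rewrite Rintegral_cst// mul0r.
move=> c f g v w [fi <-] [gi <-].
have cfi : mu.-integrable `]a, b[ (EFin \o (fun t => c * f t)).
  exact: (integrableZl _ c fi).
split; first exact: (integrableD _ cfi gi).
by rewrite RintegralD// RintegralZl.
Qed.

Section Exhaustion.
Variables (a b : R).
Hypothesis ab : a < b.

(* The factor 1/3 keeps the end points a + e n and b - e n in order. *)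
Let e (n : nat) : R := (b - a) / 3 * harmonic n.

Let e_gt0 n : 0 < e n.
Proof. by rewrite mulr_gt0 ?harmonic_gt0// divr_gt0// subr_gt0. Qed.

Let e_lt n : e n < (b - a) / 2.
Proof.
have h : harmonic n <= 1 :> R by rewrite /harmonic invf_le1// ler1n.
have ba : 0 < (b - a) / 3 by rewrite divr_gt0// subr_gt0.
apply: le_lt_trans (_ : (b - a) / 3 < _); first by rewrite ger_pMr.
by move: ba; lra.
Qed.

Let e_cvg : e @ \oo --> 0.
Proof.
rewrite -(mulr0 ((b - a) / 3)); apply: cvgMr; exact: cvg_harmonic.
Qed.

Definition inner_left n := a + e n.
Definition inner_right n := b - e n.

Lemma inner_lt n : inner_left n < inner_right n.
Proof. by rewrite /inner_left /inner_right; have := e_lt n; lra. Qed.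

Lemma inner_left_gt n : a < inner_left n.
Proof. by rewrite ltrDl. Qed.

Lemma inner_right_lt n : inner_right n < b.
Proof. by rewrite ltrBlDr ltrDl. Qed.

Lemma inner_near t : a < t < b ->
  \forall n \near \oo, inner_left n <= t <= inner_right n.
Proof.
move=> /andP[at_ tb]; near=> n.
have h1 : e n < t - a.
  by near: n; apply: (cvgr_lt _ e_cvg); rewrite subr_gt0.
have h2 : e n < b - t.
  by near: n; apply: (cvgr_lt _ e_cvg); rewrite subr_gt0.
rewrite /inner_left /inner_right; apply/andP; split; lra.
Unshelve. all: by end_near. Qed.

Lemma inner_left_cvg f (l : R) : f @ a^'+ --> l ->
  f (inner_left n) @[n --> \oo] --> l.
Proof.
move=> /cvg_at_rightP; apply; split; first exact: inner_left_gt.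
by rewrite -[X in _ --> X]addr0; apply: cvgD; [exact: cvg_cst|exact: e_cvg].
Qed.

Lemma inner_right_cvg f (l : R) : f @ b^'- --> l ->
  f (inner_right n) @[n --> \oo] --> l.
Proof.
move=> /cvg_at_leftP; apply; split; first exact: inner_right_lt.
by rewrite -[X in _ --> X]subr0; apply: cvgB; [exact: cvg_cst|exact: e_cvg].
Qed.

Lemma inner_sub n : `[inner_left n, inner_right n] `<=` `]a, b[.
Proof.
move=> t /=; rewrite !in_itv/= => /andP[h1 h2]; apply/andP; split.
  exact: lt_le_trans (inner_left_gt n) h1.
exact: le_lt_trans h2 (inner_right_lt n).
Qed.

Variables (f F : R -> R).
Hypothesis cf : {in `]a, b[, continuous f}.
Hypothesis dF : forall t, a < t < b -> is_derive t 1 F (f t).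

Lemma inner_FTC n : (\int[mu]_(t in `[inner_left n, inner_right n]) (f t)%:E
  = (F (inner_right n))%:E - (F (inner_left n))%:E)%E.
Proof.
have sub t : t \in `[inner_left n, inner_right n] -> a < t < b.
  by move=> h; have := @inner_sub n t h; rewrite /= in_itv.
apply: continuous_FTC2.
- exact: inner_lt.
- apply: continuous_in_subspaceT => t; rewrite inE => /inner_sub h.
  by apply: cf; rewrite inE.
- have F_cont t : a < t < b -> {for t, continuous F}.
    move=> h; apply/differentiable_continuous; rewrite -derivable1_diffP.
    by have [] := dF h.
  split.
  + by move=> t /subset_itv_oo_cc /sub h; have [] := dF h.
  + apply: cvg_at_right_filter; apply: F_cont; apply: sub.
    by rewrite in_itv/= lexx ltW// inner_lt.
  + apply: cvg_at_left_filter; apply: F_cont; apply: sub.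
    by rewrite in_itv/= lexx ltW// inner_lt.
- move=> t /subset_itv_oo_cc /sub h; rewrite derive1E.
  by have [_ ->] := dF h.
Qed.

Lemma measurable_fun_oo : measurable_fun `]a, b[ f.
Proof.
apply: open_continuous_measurable_fun; first exact: interval_open.
by move=> t; rewrite inE => h; apply: cf.
Qed.

(** An improper integral with a bounded primitive converges, for a nonnegative
    integrand. *)
Lemma ge0_FTC_integrable K : (forall t, a < t < b -> 0 <= f t) ->
  (forall t, a < t < b -> `|F t| <= K) ->
  mu.-integrable `]a, b[ (EFin \o f).
Proof.
move=> f0 FK; apply/integrableP; split.
  by apply/measurable_EFinP; exact: measurable_fun_oo.
have cvgI : (\int[mu]_(t in `[inner_left n, inner_right n]) (f t)%:E
    @[n --> \oo] --> \int[mu]_(t in `]a, b[) (f t)%:E)%E.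
  have -> : `]a, b[%classic = \bigcup_n `[inner_left n, inner_right n]%classic.
    apply/seteqP; split=> t /=; last by move=> [n _]; exact: inner_sub.
    rewrite in_itv/= => /inner_near[n _ /(_ n (leqnn n)) h].
    by exists n => //=; rewrite in_itv.
  apply: ge0_nondecreasing_set_cvg_integral.
  - apply/nondecreasing_seqP => n; apply/subsetPset => t /=.
    have en : e n.+1 <= e n.
      rewrite ler_wpM2l ?divr_ge0 ?subr_ge0 ?ltW//.
      by rewrite /harmonic ltf_pV2 ?posrE// ltr_nat.
    rewrite !in_itv/= /inner_left /inner_right => /andP[h1 h2].
    by apply/andP; split; lra.
  - by move=> n; exact: measurable_itv.
  - move=> n; apply/measurable_EFinP.
    by apply: measurable_funS measurable_fun_oo; [exact: measurable_itv|
      exact: inner_sub].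
  - by move=> n t /inner_sub; rewrite /= in_itv/= lee_fin; exact: f0.
apply: (@le_lt_trans _ _ (K + K)%:E); last exact: ltry.
under eq_integral => t.
  rewrite inE/= in_itv/= => h; rewrite ger0_norm ?f0//; over.
rewrite -(cvg_lim _ cvgI)//; apply: lime_le; first by apply: cvgP cvgI.
apply: nearW => n; rewrite inner_FTC -EFinB lee_fin.
have lr := inner_lt n; have al := inner_left_gt n; have rb := inner_right_lt n.
have := FK (inner_left n); rewrite al (lt_trans lr rb) => /(_ isT) h1.
have := FK (inner_right n); rewrite rb (lt_trans al lr) => /(_ isT) h2.
by apply: le_trans (ler_norm _) _; apply: le_trans (ler_normB _ _) _; rewrite lerD.
Qed.

(** Dominated convergence along the compact subintervals, on each of which the
    fundamental theorem applies. *)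
Lemma FTC_oo (la lb : R) : mu.-integrable `]a, b[ (EFin \o f) ->
  F @ a^'+ --> la -> F @ b^'- --> lb -> rint a b f (lb - la).
Proof.
move=> fi Fa Fb; split => //.
pose I n := `[inner_left n, inner_right n]%classic.
pose g n := (EFin \o f) \_ (I n).
have mD : measurable (`]a, b[ : set R) by exact: measurable_itv.
have gE n : (\int[mu]_(t in `]a, b[) g n t
    = (F (inner_right n) - F (inner_left n))%:E)%E.
  by rewrite /g -integral_mkcondr (setIidr (@inner_sub n)) inner_FTC EFinB.
have h : (\int[mu]_(t in `]a, b[) g n t @[n --> \oo] -->
          \int[mu]_(t in `]a, b[) (f t)%:E)%E.
  apply: (@dominated_cvg _ _ _ mu _ mD g (EFin \o f) (fun t => `|(f t)%:E|%E)).
  - move=> n; apply/measurable_restrict => //; first exact: measurable_itv.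
    apply: measurable_funS (measurable_int _ fi) => //.
  - move=> t /=; rewrite in_itv/= => tab; apply: cvg_near_cst.
    apply: filterS (inner_near tab) => n h.
    by rewrite /g patchE mem_set//= /I /= in_itv.
  - by [].
  - exact: integrable_abse.
  - move=> n t _; rewrite /g patchE; case: ifPn => // _.
    by rewrite abse0 abse_ge0.
have h' : ((F (inner_right n) - F (inner_left n))%:E @[n --> \oo] -->
    (lb - la)%:E)%E.
  by apply: cvg_EFin; [exact: nearW|]; apply: cvgB; [exact: inner_right_cvg|
    exact: inner_left_cvg].
rewrite /Rintegral -(cvg_lim _ h)//.
by under eq_fun do rewrite gE; rewrite (cvg_lim _ h').
Qed.

End Exhaustion.

(** * Scaling of Lebesgue measure *)

Lemma measurable_dilation (x : R) :
  @measurable_fun _ _ (measurableTypeR R) (measurableTypeR R) setT ( *%R x).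
Proof. exact: mulrl_measurable. Qed.

(** The measure structure of a pushforward depends on a proof of measurability,
    here supplied explicitly. *)
Definition dilated_lebesgue (x : R) (x0 : 0 < x) : measure (measurableTypeR R) R :=
  mscale (NngNum (ltW x0))
    (measure_function_pushforward__canonical__measure_function_Measure mu
      (measurable_dilation x)).

(** Both sides are measures in A which agree on half-open intervals. *)
Lemma lebesgue_measure_scale (x : R) (x0 : 0 < x) (A : set R) : measurable A ->
  mu A = dilated_lebesgue x0 A.
Proof.
move=> mA; have := @lebesgue_measure_unique R (dilated_lebesgue x0).
apply => // _ [[a b] _ <-] /=.
rewrite /mscale /=.
rewrite [X in (_ * X)%E](_ : _ = mu ( *%R x @^-1` `]a, b]))//.
have -> : ( *%R x @^-1` `]a, b])%classic = `]a / x, b / x]%classic.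
  by apply/seteqP; split=> t /=; rewrite !in_itv/= ltr_pdivrMr// ler_pdivlMr//
    ![t * x]mulrC.
rewrite /mu !lebesgue_measure_itv/= !lte_fin ltr_pM2r ?invr_gt0//.
case: ifPn => _; last by rewrite mule0.
by rewrite -!EFinB -EFinM -mulrBl mulrCA divff ?mulr1// gt_eqF.
Qed.

Lemma ge0_integral_scale (x : R) (f : R -> \bar R) : 0 < x ->
  measurable_fun setT f -> (forall t, 0 <= f t)%E ->
  (\int[mu]_t f t = x%:E * \int[mu]_t f (x * t)%R)%E.
Proof.
move=> x0 mf f0.
have mx := measurable_dilation x.
rewrite (@eq_measure_integral _ _ _ _ (dilated_lebesgue x0)); last first.
  by move=> A mA _; exact: lebesgue_measure_scale.
by rewrite ge0_integral_mscale//= ge0_integral_pushforward//= preimage_setT.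
Qed.

(** The substitution t = x u, obtained from the scaling of the measure on the
    positive and negative parts of the integrand. *)
Lemma rint_scale (x : R) (f : R -> R) (v : R) : 0 < x ->
  rint 0 1 (fun u => x * f (x * u)) v -> rint 0 x f v.
Proof.
move=> x0 [fi fv].
have m01 : @measurable _ (measurableTypeR R) `]0, 1[%classic by exact: measurable_itv.
have m0x : @measurable _ (measurableTypeR R) `]0, x[%classic by exact: measurable_itv.
pose g := (EFin \o f) \_ `]0, x[%classic.
pose h := (EFin \o (fun u => f (x * u))) \_ `]0, 1[%classic.
have gh u : g (x * u) = h u.
  rewrite /g /h !patchE !mem_setE !in_itv/= pmulr_rgt0// gtr_pMr//.
have hi : mu.-integrable `]0, 1[ (EFin \o (fun u => f (x * u))).
  have := integrableZl m01 x^-1 fi; congr integrable; apply/funext => u /=.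
  by rewrite -EFinM mulKf// gt_eqF.
have hi' : mu.-integrable setT h by exact: (integrable_mkcond _ m01).1 hi.
have mg : measurable_fun setT g.
  have -> : g = h \o ( *%R x^-1).
    by apply/funext => t; rewrite /= -gh mulVKf// gt_eqF.
  apply: measurableT_comp; first exact: measurable_int hi'.
  exact: mulrl_measurable.
have gi' : mu.-integrable setT g.
  apply/integrableP; split=> //.
  rewrite (ge0_integral_scale x0)//; last exact: measurableT_comp.
  have /integrableP[_ hfin] := hi'.
  under eq_integral do rewrite gh.
  by rewrite lte_mul_pinfty// lee_fin ltW.
have gi : mu.-integrable `]0, x[ (EFin \o f) by exact: (integrable_mkcond _ m0x).2 gi'.
split => //; rewrite -fv RintegralZl// /Rintegral.
rewrite [in LHS]integral_mkcond [in RHS]integral_mkcond -/g -/h.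
have := integrable_fin_num measurableT hi'.
suff -> : (\int[mu]_t g t = x%:E * \int[mu]_t h t)%E.
  by move=> fin; rewrite fineM.
have hp : (\int[mu]_t g^\+ t = x%:E * \int[mu]_t h^\+ t)%E.
  rewrite (ge0_integral_scale x0)//; last exact: measurable_funepos.
  by congr (_ * _)%E; apply: eq_integral => t _; rewrite !funeposE gh.
have hn : (\int[mu]_t g^\- t = x%:E * \int[mu]_t h^\- t)%E.
  rewrite (ge0_integral_scale x0)//; last exact: measurable_funeneg.
  by congr (_ * _)%E; apply: eq_integral => t _; rewrite !funenegE gh.
rewrite [LHS]integralE hp hn -muleBr//; first by rewrite -integralE.
exact: integrable_add_def measurableT _ hi'.
Qed.

End OpenInterval.

(** * Growth of Pochhammer products *)

Section Pochhammer.
Context {R : realType} {N : nat}.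
Implicit Types (A B M X : 'M[R[i]]_N) (c d : nat -> 'M[R[i]]_N).

Lemma mxpoch0 M : mxpoch M 0 = 1.
Proof. by rewrite /mxpoch big_geq. Qed.

Lemma mxpochS M k : mxpoch M k.+1 = mxpoch M k * (M + k%:R%:M).
Proof. by rewrite /mxpoch big_nat_recr. Qed.

Lemma comm_addn X M k : GRing.comm X M -> GRing.comm X (M + k%:R%:M).
Proof. by move=> XM; apply: commrD => //; exact: comm_mx_scalar. Qed.

Lemma comm_mxpoch X M k : GRing.comm X M -> GRing.comm X (mxpoch M k).
Proof. by move=> XM; apply: commr_prod => j _; exact: comm_addn. Qed.

Lemma comm_invmx X M : GRing.comm X M -> GRing.comm X (invmx M).
Proof.
move=> XM; have [Mu|Mnu] := boolP (M \in unitmx); last by rewrite /invmx (negPf Mnu).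
have e : M * invmx M = 1 by exact: mulmxV.
have e' : invmx M * M = 1 by exact: mulVmx.
transitivity (invmx M * (M * X) * invmx M); first by rewrite mulrA e' mul1r.
by rewrite -XM -!mulrA e mulr1.
Qed.

Lemma invmxM A B : A \in unitmx -> B \in unitmx ->
  invmx (A * B) = invmx B * invmx A.
Proof.
move=> Au Bu; have e : A * B * invmx (A * B) = 1 by apply: mulmxV; rewrite unitmx_mul Au.
have eA : invmx A * A = 1 by exact: mulVmx.
have eB : invmx B * B = 1 by exact: mulVmx.
transitivity (invmx B * (invmx A * A) * B * invmx (A * B)).
  by rewrite eA mulr1 eB mul1r.
by rewrite !mulrA -(mulrA _ A) -(mulrA _ (A * B)) e mulr1.
Qed.

Lemma mxpoch_unit M k : (forall s : nat, M + (s%:R)%:M \in unitmx) ->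
  mxpoch M k \in unitmx.
Proof.
move=> Mu; elim: k => [|k IH]; first by rewrite mxpoch0 unitmx1.
by rewrite mxpochS unitmx_mul IH Mu.
Qed.

Lemma geom_bounded_mul c d : geom_bounded c -> geom_bounded d ->
  geom_bounded (fun k => c k * d k).
Proof.
move=> [D [K [K0 h]]] [D' [K' [K'0 h']]]; exists (D * D'), (K * K').
split=> [|k]; first exact: mulr_ge0.
apply: le_trans (mxnM _ _) _; rewrite exprMn mulrACA.
by apply: ler_pM; rewrite ?mxn_ge0.
Qed.

Lemma geom_bounded_rec c (r : nat -> 'M[R[i]]_N) K : 0 <= K ->
  (forall k, c k.+1 = r k * c k) -> (forall k, mxn (r k) <= K) ->
  geom_bounded c.
Proof.
move=> K0 cS rK; exists (mxn (c 0)), K; split=> //.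
elim=> [|k IH]; first by rewrite expr0 mulr1.
rewrite cS exprS mulrCA; apply: le_trans (mxnM _ _) _.
by apply: ler_pM; rewrite ?mxn_ge0.
Qed.

(** From k X = 1 - X B for the inverse X of B + k, which gives |X| <= |1| as
    soon as k >= |B| + 1. *)
Lemma invmx_addn_bounded B : (forall s : nat, B + (s%:R)%:M \in unitmx) ->
  exists K, 0 <= K /\ forall k : nat, mxn (invmx (B + k%:R%:M)) <= K.
Proof.
move=> Bu; pose X k := invmx (B + k%:R%:M).
have large k : mxn B + 1 <= k%:R -> mxn (X k) <= mxn (1 : 'M[R[i]]_N).
  move=> Bk; have XB : X k * (B + k%:R%:M) = 1 by exact: mulVmx.
  have kX : k%:R%:C *: X k = 1 + - (X k * B).
    rewrite -XB mulrDr addrAC subrr add0r rmorph_nat.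
    by rewrite -[_ * _]/(_ *m _) mul_mx_scalar.
  have : k%:R * mxn (X k) <= mxn (1 : 'M[R[i]]_N) + mxn (X k) * mxn B.
    have := mxnD 1 (- (X k * B)); rewrite -kX mxnZ ger0_norm// mxnN.
    by move=> /le_trans; apply; rewrite lerD2l mxnM.
  have := ler_wpM2r (mxn_ge0 (X k)) Bk; lra.
have [k0 Bk0] : exists k0 : nat, mxn B + 1 <= k0%:R.
  exists (Num.bound (mxn B + 1)); apply/ltW/archi_boundP.
  by rewrite addr_ge0// mxn_ge0.
have S0 : 0 <= \sum_(k < k0) mxn (X k) by apply: sumr_ge0 => k _; exact: mxn_ge0.
exists (mxn (1 : 'M[R[i]]_N) + \sum_(k < k0) mxn (X k)); split.
  by rewrite addr_ge0 ?mxn_ge0.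
move=> k; have [kk0|k0k] := ltnP k k0.
  apply: le_trans (_ : \sum_(k < k0) mxn (X k) <= _); last by rewrite lerDr mxn_ge0.
  rewrite (bigD1 (Ordinal kk0))//= lerDl.
  by apply: sumr_ge0 => j _; exact: mxn_ge0.
apply: le_trans (_ : mxn (1 : 'M[R[i]]_N) <= _); last by rewrite lerDl.
by apply: large; apply: le_trans Bk0 _; rewrite ler_nat.
Qed.

Lemma geom_bounded_invmx_mxpoch B : (forall s : nat, B + (s%:R)%:M \in unitmx) ->
  geom_bounded (fun k => invmx (mxpoch B k)).
Proof.
move=> Bu; have [K [K0 h]] := invmx_addn_bounded Bu.
apply: (geom_bounded_rec K0 _ h) => k.
by rewrite mxpochS invmxM ?mxpoch_unit.
Qed.

(** The consecutive quotients (A + k)(B + k)^-1 = 1 + (A - B)(B + k)^-1 are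
    bounded. *)
Lemma geom_bounded_mxpoch_ratio A B : GRing.comm A B ->
  (forall s : nat, B + (s%:R)%:M \in unitmx) ->
  geom_bounded (fun k => mxpoch A k * invmx (mxpoch B k)).
Proof.
move=> AB Bu; have [K [K0 h]] := invmx_addn_bounded Bu.
pose r k := (A + k%:R%:M) * invmx (B + k%:R%:M).
apply: (@geom_bounded_rec _ r (mxn (1 : 'M[R[i]]_N) + mxn (A - B) * K)).
- by rewrite addr_ge0 ?mulr_ge0 ?mxn_ge0.
- move=> k; rewrite !mxpochS (invmxM (mxpoch_unit k Bu) (Bu k)) /r.
  have c : GRing.comm (mxpoch A k) ((A + k%:R%:M) * invmx (B + k%:R%:M)).
    have AA : GRing.comm (mxpoch A k) A by exact/commr_sym/comm_mxpoch.
    apply: commrM; first exact: comm_addn.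
    by apply/comm_invmx/comm_addn/commr_sym/comm_mxpoch/commr_sym.
  by rewrite [RHS]mulrA -c !mulrA.
- move=> k; rewrite /r.
  have -> : (A + k%:R%:M) * invmx (B + k%:R%:M)
      = 1 + (A - B) * invmx (B + k%:R%:M).
    rewrite -{1}(subrK B A) -addrA mulrDl [LHS]addrC; congr (_ + _).
    exact: mulmxV (Bu k).
  apply: le_trans (mxnD _ _) _; rewrite lerD2l.
  by apply: le_trans (mxnM _ _) _; rewrite ler_wpM2l ?mxn_ge0.
Qed.

End Pochhammer.

(** * The matrix beta integral *)

Section MatrixIntegral.
Context {R : realType} {N : nat}.
Implicit Types (F G : R -> 'M[R[i]]_N) (V : 'M[R[i]]_N) (a b : R).
Let mu := @lebesgue_measure R.

Definition mxint a b F V : Prop := mxlift (rint a b) F V.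

Lemma mxintP a b F V :
  mxint a b F V <-> mxintegrable a b F /\ mxintegral a b F = V.
Proof.
split=> [FV|[Fi <-]].
  split; first by move=> i j; have [[? _] [? _]] := FV i j.
  apply/matrixP => i j; rewrite mxE; have [[_ ->] [_ ->]] := FV i j.
  by case: (V i j).
by move=> i j; have [h1 h2] := Fi i j; split; rewrite mxE; split.
Qed.

Lemma mxint_unique a b F V W : mxint a b F V -> mxint a b F W -> V = W.
Proof. by move=> /mxintP[_ <-] /mxintP[_ <-]. Qed.

Lemma rint_congr a b (f g : R -> R) v : (forall t, a < t < b -> f t = g t) ->
  rint a b f v -> rint a b g v.
Proof.
move=> fg [fi fv]; split.
  apply: eq_integrable fi => [|t]; first exact: measurable_itv.
  by rewrite inE/= in_itv/= => h; rewrite /= fg.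
rewrite -fv; apply: eq_Rintegral => t; rewrite inE/= in_itv/= => h.
by rewrite fg.
Qed.

Lemma mxint_congr a b F G V : (forall t, a < t < b -> F t = G t) ->
  mxint a b F V -> mxint a b G V.
Proof.
move=> FG FV i j; have [h1 h2] := FV i j.
by split; [apply: rint_congr h1|apply: rint_congr h2] => t /FG ->.
Qed.

Lemma rderive_continuous t (f : R -> R) d : rderive t f d -> {for t, continuous f}.
Proof.
move=> [fd _]; apply/differentiable_continuous.
by rewrite -derivable1_diffP.
Qed.

Lemma rint_dominated a b (f g : R -> R) : {in `]a, b[, continuous f} ->
  mu.-integrable `]a, b[ (EFin \o g) ->
  (forall t, a < t < b -> `|f t| <= g t) ->
  rint a b f (\int[mu]_(t in `]a, b[) f t).
Proof.
move=> cf gi fg; split => //; apply: le_integrable gi.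
- exact: measurable_itv.
- by apply/measurable_EFinP; exact: measurable_fun_oo.
- move=> t; rewrite /= in_itv/= => h; rewrite lee_fin.
  exact: le_trans (fg t h) (ler_norm _).
Qed.

Lemma mxint_dominated a b F (g : R -> R) :
  (forall t, a < t < b -> exists V, mxderive t F V) ->
  mu.-integrable `]a, b[ (EFin \o g) ->
  (forall t, a < t < b -> mxn (F t) <= g t) ->
  mxint a b F (mxintegral a b F).
Proof.
move=> dF gi Fg i j; rewrite mxE; split; apply: rint_dominated gi _.
- move=> t; rewrite in_itv/= => /dF[V /(_ i j)[h _]].
  exact: rderive_continuous h.
- by move=> t /Fg; apply: le_trans; exact: Re_mxn.
- move=> t; rewrite in_itv/= => /dF[V /(_ i j)[_ h]].
  exact: rderive_continuous h.
- by move=> t /Fg; apply: le_trans; exact: Im_mxn.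
Qed.

(** The value of the integral is left existential: what identifies it in
    applications is the limit of the v n. *)
Lemma rint_dominated_cvg a b (f : nat -> R -> R) (F g : R -> R) (v : nat -> R) :
  (forall n, rint a b (f n) (v n)) ->
  (forall t, a < t < b -> rcvgn (fun n => f n t) (F t)) ->
  mu.-integrable `]a, b[ (EFin \o g) ->
  (forall n t, a < t < b -> `|f n t| <= g t) ->
  exists w, rint a b F w /\ rcvgn v w.
Proof.
move=> fv fF gi fg; have mI : @measurable _ (measurableTypeR R) `]a, b[%classic.
  exact: measurable_itv.
have m n : measurable_fun `]a, b[ (EFin \o f n).
  by have [h _] := fv n; exact: measurable_int h.
have c t : `]a, b[%classic t -> (EFin \o f n) t @[n --> \oo] --> (EFin \o F) t.
  rewrite /= in_itv/= => /fF h; apply: cvg_EFin => //; exact: nearW.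
have fin t : `]a, b[%classic t -> (EFin \o g) t \is a fin_num by [].
have dom n t : `]a, b[%classic t -> (`|(EFin \o f n) t| <= (EFin \o g) t)%E.
  by rewrite /= in_itv/= lee_fin; exact: fg.
have Fi := lebesgue_integral_dominated_convergence.dominated_integrable mI
  (fun n => EFin \o f n) _ _ m c gi dom.
have := dominated_cvg mI m c fin gi dom.
exists (\int[mu]_(t in `]a, b[) F t); split => //.
have -> : v = fun n => fine (\int[mu]_(t in `]a, b[) (f n t)%:E).
  by apply/funext => n; have [_ <-] := fv n.
apply: fine_cvg; rewrite fineK//; exact: integrable_fin_num.
Qed.

Lemma mxint_dominated_cvg a b (f : nat -> R -> 'M[R[i]]_N) F (g : R -> R)
    (v : nat -> 'M[R[i]]_N) :
  (forall n, mxint a b (f n) (v n)) ->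
  (forall t, a < t < b -> mxcvgn (fun n => f n t) (F t)) ->
  mu.-integrable `]a, b[ (EFin \o g) ->
  (forall n t, a < t < b -> mxn (f n t) <= g t) ->
  exists V, mxint a b F V /\ mxcvgn v V.
Proof.
move=> fv fF gi fg.
have Re i j := @rint_dominated_cvg a b (fun n t => complex.Re (f n t i j))
  (fun t => complex.Re (F t i j)) g _ (fun n => (fv n i j).1)
  (fun t h => (fF t h i j).1) gi
  (fun n t h => le_trans (Re_mxn _ _ _) (fg n t h)).
have Im i j := @rint_dominated_cvg a b (fun n t => complex.Im (f n t i j))
  (fun t => complex.Im (F t i j)) g _ (fun n => (fv n i j).2)
  (fun t h => (fF t h i j).2) gi
  (fun n t h => le_trans (Im_mxn _ _ _) (fg n t h)).
exists (mxintegral a b F); split=> i j; have [p [p1 p2]] := Re i j;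
  have [q [q1 q2]] := Im i j; rewrite mxE.
  by split => /=; split=> //; have [] := p1; have [] := q1.
by split => /=; [have [_ ->] := p1|have [_ ->] := q1].
Qed.

End MatrixIntegral.

Section Beta.
Context {R : realType} {N : nat}.
Let mu := @lebesgue_measure R.

Lemma is_derive_powR (d t : R) : 0 < t ->
  is_derive t 1 (fun s : R => s `^ d) (d * t `^ (d - 1)).
Proof.
move=> t0; apply: DeriveDef; first by apply: derivable_powR; rewrite in_itv/= t0.
by rewrite -derive1E powR_derive1// in_itv/= t0.
Qed.

Lemma continuous_powR (d t : R) : 0 < t -> {for t, continuous (fun s : R => s `^ d)}.
Proof. by move=> t0; apply: (rderive_continuous (is_derive_powR d t0)). Qed.

Lemma is_derive_onem (t : R) : is_derive t 1 (fun s : R => 1 - s) (-1).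
Proof. by apply: is_derive_eq; rewrite add0r mul1r. Qed.

Lemma powR_le1 (r s : R) : 0 < r < 1 -> 0 < s -> r `^ s <= 1.
Proof.
move=> /andP[r0 r1] s0; have h := @ge0_ler_powR _ s (ltW s0) r 1.
by rewrite powR1 in h; apply: h; rewrite ?nnegrE ?ltW.
Qed.

Lemma onem_in01 (t : R) : 0 < t < 1 -> 0 < 1 - t < 1.
Proof. by move=> /andP[t0 t1]; apply/andP; split; lra. Qed.

Definition beta_dominant (p q t : R) : R := t `^ (p - 1) + (1 - t) `^ (q - 1).

(** The primitive t^p / p - (1-t)^q / q is bounded. *)
Lemma beta_dominant_integrable (p q : R) : 0 < p -> 0 < q ->
  mu.-integrable `]0, 1[ (EFin \o beta_dominant p q).
Proof.
move=> p0 q0.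
apply: (@ge0_FTC_integrable _ 0 1 ltr01 _
  (fun t => p^-1 * t `^ p - q^-1 * (1 - t) `^ q) _ _ (p^-1 + q^-1)).
- move=> t; rewrite in_itv/= => /andP[t0 t1]; apply: cvgD.
    exact: continuous_powR.
  apply: (@continuous_comp _ _ _ (fun s : R => 1 - s) (fun s : R => s `^ (q - 1))).
    by apply: cvgB; [exact: cvg_cst|exact: cvg_id].
  by apply: continuous_powR; rewrite subr_gt0.
- move=> t /andP[t0 t1].
  have d1 := is_derive_powR p t0.
  have d2 : is_derive t 1 (fun s : R => (1 - s) `^ q)
      (q * (1 - t) `^ (q - 1) * -1).
    apply: (@is_derive1_comp _ (fun s : R => s `^ q)); last exact: is_derive_onem.
    by apply: is_derive_powR; rewrite subr_gt0.
  apply: is_derive_eq; rewrite /GRing.scale /= /beta_dominant.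
  by field; rewrite !gt_eqF.
- by move=> t _; rewrite addr_ge0// powR_ge0.
- move=> t /andP[t0 t1]; apply: le_trans (ler_normB _ _) _.
  have t01 : 0 < t < 1 by rewrite t0.
  have le1 (r s : R) : 0 < r < 1 -> 0 < s -> `|s^-1 * r `^ s| <= s^-1.
    move=> r01 s0; rewrite ger0_norm; last first.
      by rewrite mulr_ge0 ?powR_ge0// invr_ge0 ltW.
    by rewrite ger_pMr ?invr_gt0// powR_le1.
  by rewrite lerD// le1// onem_in01.
Qed.

Variables (P Q : 'M[R[i]]_N).
Hypotheses (PQ : GRing.comm P Q) (Pst : positive_stable P) (Qst : positive_stable Q).

Definition beta_primitive (t : R) : 'M[R[i]]_N := mxrpow t P * mxrpow (1 - t) Q.

Lemma mxbeta_integrandE t : 0 < t < 1 -> mxbeta_integrand P Q t =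
  ((t * (1 - t))^-1)%:C *: beta_primitive t.
Proof.
move=> /andP[t0 t1]; rewrite /mxbeta_integrand -[_ *m _]/(_ * _).
rewrite !mxrpow_sub1 ?subr_gt0// -mxscalerAl -mxscalerAr scalerA -rmorphM.
by rewrite invfM.
Qed.

Lemma beta_primitive_bound : exists C p q, [/\ 0 <= C, 0 < p, 0 < q &
  forall t, 0 < t < 1 ->
    mxn (beta_primitive t) <= C * (t `^ p * (1 - t) `^ q)].
Proof.
have [p [C [p0 C0 hP]]] := mxrpow_decay Pst.
have [q [C' [q0 C'0 hQ]]] := mxrpow_decay Qst.
exists (C * C'), p, q; split => //; first exact: mulr_ge0.
move=> t /andP[t0 t1]; apply: le_trans (mxnM _ _) _; rewrite mulrACA.
apply: ler_pM; rewrite ?mxn_ge0//.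
  by apply: hP; rewrite t0 ltW.
by apply: hQ; rewrite subr_gt0 t1 gerBl ltW.
Qed.

(** Since 1/(t(1-t)) = 1/t + 1/(1-t), a bound by t^p (1-t)^q on the primitive
    gives one by t^(p-1) + (1-t)^(q-1) on the integrand. *)
Lemma mxbeta_integrand_bound : exists C p q, [/\ 0 <= C, 0 < p, 0 < q &
  forall t, 0 < t < 1 -> mxn (mxbeta_integrand P Q t) <= C * beta_dominant p q t].
Proof.
have [C [p [q [C0 p0 q0 h]]]] := beta_primitive_bound.
exists C, p, q; split => // t t01; have /andP[t0 t1] := t01.
have s0 : 0 < 1 - t by rewrite subr_gt0.
rewrite mxbeta_integrandE// mxnZ ger0_norm; last first.
  by rewrite invr_ge0 mulr_ge0 ?ltW.
apply: le_trans (ler_wpM2l _ (h t t01)) _; first by rewrite invr_ge0 mulr_ge0 ?ltW.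
have powRB1 (r s : R) : 0 < r -> r `^ (s - 1) = r `^ s / r.
  by move=> r0; rewrite powRB ?(gt_eqF r0) ?implybT// powRr1// ltW.
rewrite mulrCA ler_wpM2l// /beta_dominant !powRB1//.
have p1 := powR_le1 t01 p0; have q1 := powR_le1 (onem_in01 t01) q0.
rewrite [leLHS](_ : _ = t `^ p / t * (1 - t) `^ q + (1 - t) `^ q / (1 - t) * t `^ p).
  by apply: lerD; rewrite ger_pMr// ?divr_gt0 ?powR_gt0.
by field; rewrite !gt_eqF.
Qed.

Lemma mxderive_onem t (M : 'M[R[i]]_N) : t < 1 -> mxderive t (fun s => mxrpow (1 - s) M)
  (- (((1 - t)^-1)%:C *: (mxrpow (1 - t) M * M))).
Proof.
move=> t1; have s0 : 0 < 1 - t by rewrite subr_gt0.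
apply: (mxlift_eq (mxderive_comp (is_derive_onem t) (mxderive_mxrpow M s0))) => //.
by rewrite rmorphN1 scaleN1r.
Qed.

Lemma mxbeta_integrand_derivable t : 0 < t < 1 ->
  exists V, mxderive t (mxbeta_integrand P Q) V.
Proof.
move=> /andP[t0 t1]; eexists; apply: mxderiveM (mxderive_mxrpow _ t0) _.
exact: mxderive_onem.
Qed.

Lemma mxbeta_integrand_mxint : mxint 0 1 (mxbeta_integrand P Q) (mxbeta P Q).
Proof.
have [C [p [q [C0 p0 q0 h]]]] := mxbeta_integrand_bound.
apply: (mxint_dominated mxbeta_integrand_derivable _ h).
exact: integrableZl _ (beta_dominant_integrable p0 q0).
Qed.

End Beta.

(** * The recursion of the beta function *)

Section BetaRecursion.
Context {R : realType} {N : nat}.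
Implicit Types (P Q : 'M[R[i]]_N).

Lemma positive_stable_addn P k : positive_stable P ->
  positive_stable (P + k%:R%:M).
Proof.
move=> Pst a /eigenvalueP[v va v0].
have : eigenvalue P (a - k%:R).
  apply/eigenvalueP; exists v => //.
  by rewrite scalerBl -va mulmxDr mul_mx_scalar addrK.
move=> /Pst; case: a {va} => x y; rewrite -(rmorph_nat (real_complex R)) /=.
by rewrite subr_gt0; apply: le_lt_trans.
Qed.

Lemma comm_addn2 P Q k : GRing.comm P Q -> GRing.comm (P + k%:R%:M) Q.
Proof. by move=> PQ; exact/commr_sym/comm_addn/commr_sym. Qed.

Lemma positive_stableD_addn_unit P Q (s : nat) : GRing.comm P Q ->
  positive_stable P -> positive_stable Q -> P + Q + (s%:R)%:M \in unitmx.
Proof.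
move=> PQ Pst Qst; rewrite -[_ + _ + _]addrA.
by apply: positive_stableD_unit Pst (@positive_stable_addn Q s Qst); exact: comm_addn.
Qed.

Lemma mxbeta_integrand_addn P Q k t : 0 < t ->
  mxbeta_integrand (P + k%:R%:M) Q t = (t ^+ k)%:C *: mxbeta_integrand P Q t.
Proof.
move=> t0; rewrite -[LHS]/(mxrpow t (P + k%:R%:M - 1%:M) * mxrpow (1 - t) (Q - 1%:M)).
by rewrite [P + _ - _]addrAC mxrpow_addn// -mxscalerAl.
Qed.

Lemma beta_primitive_derive P Q t : GRing.comm P Q -> 0 < t < 1 ->
  mxderive t (beta_primitive P Q)
    (mxbeta_integrand P Q t * P - mxbeta_integrand (P + 1%:R%:M) Q t * (P + Q)).
Proof.
move=> PQ t01; have /andP[t0 t1] := t01.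
apply: (mxlift_eq (mxderiveM (mxderive_mxrpow P t0) (mxderive_onem Q t1))) => //.
rewrite mxbeta_integrand_addn// mxbeta_integrandE// /beta_primitive.
have PV := mxrpow_comm (1 - t) PQ.
move: (mxrpow t P) (mxrpow (1 - t) Q) PV => U V PV.
have e1 (a : R[i]) : a *: (U * P) * V = a *: (U * V * P).
  by rewrite -mxscalerAl -!mulrA PV.
have e2 (a : R[i]) : U * - (a *: (V * Q)) = - (a *: (U * V * Q)).
  by rewrite mulrN -mxscalerAr mulrA.
rewrite e1 e2 -!mxscalerAl scalerA -rmorphM (mulrDr (U * V)) scalerDr opprD addrA -scalerBl.
rewrite -rmorphB; have t_neq0 : t != 0 by rewrite gt_eqF.
have onem_neq0 : 1 - t != 0 by rewrite gt_eqF// subr_gt0.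
have -> : (t * (1 - t))^-1 - t ^+ 1 * (t * (1 - t))^-1 = t^-1.
  by field; apply/andP.
have -> // : t ^+ 1 * (t * (1 - t))^-1 = (1 - t)^-1.
by field; apply/andP.
Qed.

Lemma powR_onem_cvg0 (q : R) : 0 < q -> (1 - t) `^ q @[t --> 1^'-] --> 0.
Proof.
move=> q0; apply/cvg_at_leftP => u [u1 ucvg].
have /cvg_at_rightP := powR_cvg0 q0; apply; split=> [n|].
  by rewrite subr_gt0.
by rewrite -(subrr 1); apply: cvgB => //; exact: cvg_cst.
Qed.

Lemma beta_bound_cvg0 (f : R -> R) (C p q : R) : 0 <= C -> 0 < p -> 0 < q ->
  (forall t, 0 < t < 1 -> `|f t| <= C * (t `^ p * (1 - t) `^ q)) ->
  f @ 0^'+ --> 0 /\ f @ 1^'- --> 0.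
Proof.
move=> C0 p0 q0 fC.
have f1 t : 0 < t < 1 -> `|f t| <= C * t `^ p.
  move=> t01; apply: le_trans (fC t t01) _; rewrite ler_wpM2l//.
  by rewrite ler_piMr ?powR_ge0// powR_le1// onem_in01.
have f2 t : 0 < t < 1 -> `|f t| <= C * (1 - t) `^ q.
  move=> t01; apply: le_trans (fC t t01) _; rewrite ler_wpM2l//.
  by rewrite ler_piMl ?powR_ge0// powR_le1.
split.
- have c : C * t `^ p @[t --> 0^'+] --> C * 0 by apply: cvgMr; exact: powR_cvg0.
  have c' : - (C * t `^ p) @[t --> 0^'+] --> - (C * 0) by exact: cvgN.
  rewrite mulr0 in c; rewrite mulr0 oppr0 in c'.
  apply: (squeeze_cvgr _ c' c); near=> t; rewrite -ler_norml; apply: f1.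
  apply/andP; split; first by near: t; exact: nbhs_right_gt.
  by near: t; exact: nbhs_right_lt.
- have c : C * (1 - t) `^ q @[t --> 1^'-] --> C * 0.
    by apply: cvgMr; exact: powR_onem_cvg0.
  have c' : - (C * (1 - t) `^ q) @[t --> 1^'-] --> - (C * 0) by exact: cvgN.
  rewrite mulr0 in c; rewrite mulr0 oppr0 in c'.
  apply: (squeeze_cvgr _ c' c); near=> t; rewrite -ler_norml; apply: f2.
  apply/andP; split; last by near: t; exact: nbhs_left_lt.
  by near: t; exact: nbhs_left_gt.
Unshelve. all: by end_near. Qed.

(** Integrating the derivative of t^P (1-t)^Q, which vanishes at both ends. *)
Lemma mxbeta_rec P Q : GRing.comm P Q -> positive_stable P -> positive_stable Q ->
  mxbeta P Q * P = mxbeta (P + 1%:R%:M) Q * (P + Q).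
Proof.
move=> PQ Pst Qst; have P1st := @positive_stable_addn P 1 Pst.
pose W t := mxbeta_integrand P Q t * P - mxbeta_integrand (P + 1%:R%:M) Q t * (P + Q).
have I1 : mxint 0 1 W (mxbeta P Q * P - mxbeta (P + 1%:R%:M) Q * (P + Q)).
  apply: (mxliftB (rint_linear 0 1)); apply: (mxliftMr (rint_linear 0 1));
    exact: mxbeta_integrand_mxint.
suff I2 : mxint 0 1 W 0.
  by apply/eqP; rewrite -subr_eq0; apply/eqP; exact: mxint_unique I1 I2.
have dW t : 0 < t < 1 -> exists V, mxderive t W V.
  move=> t01; have [V1 d1] := mxbeta_integrand_derivable P Q t01.
  have [V2 d2] := mxbeta_integrand_derivable (P + 1%:R%:M) Q t01.
  eexists; apply: (mxliftB (rderive_linear t)); apply: (mxliftMr (rderive_linear t));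
    [exact: d1|exact: d2].
have [C [p [q [C0 p0 q0 bd]]]] := beta_primitive_bound Pst Qst.
move=> i j; rewrite mxE; have [[i1 _] [i2 _]] := I1 i j; split.
- have [c0 c1] : complex.Re (beta_primitive P Q t i j) @[t --> 0^'+] --> 0 /\
                 complex.Re (beta_primitive P Q t i j) @[t --> 1^'-] --> 0.
    apply: beta_bound_cvg0 C0 p0 q0 _ => t /bd.
    by apply: le_trans; exact: Re_mxn.
  rewrite /= -[X in rint _ _ _ X](subrr 0).
  apply: (FTC_oo ltr01 _ _ i1 c0 c1) => t.
    rewrite in_itv/= => /dW[V /(_ i j)[h _]]; exact: rderive_continuous h.
  by move=> t01; have [h _] := beta_primitive_derive PQ t01 i j.
- have [c0 c1] : complex.Im (beta_primitive P Q t i j) @[t --> 0^'+] --> 0 /\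
                 complex.Im (beta_primitive P Q t i j) @[t --> 1^'-] --> 0.
    apply: beta_bound_cvg0 C0 p0 q0 _ => t /bd.
    by apply: le_trans; exact: Im_mxn.
  rewrite /= -[X in rint _ _ _ X](subrr 0).
  apply: (FTC_oo ltr01 _ _ i2 c0 c1) => t.
    rewrite in_itv/= => /dW[V /(_ i j)[_ h]]; exact: rderive_continuous h.
  by move=> t01; have [_ h] := beta_primitive_derive PQ t01 i j.
Qed.

Lemma mxbeta_addn P Q k : GRing.comm P Q -> positive_stable P ->
  positive_stable Q -> mxbeta (P + k%:R%:M) Q =
  mxbeta P Q * (mxpoch P k * invmx (mxpoch (P + Q) k)).
Proof.
move=> PQ Pst Qst.
have Du s := positive_stableD_addn_unit s PQ Pst Qst.
elim: k => [|k IH].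
  rewrite !mxpoch0 raddf0 addr0.
  have -> : invmx (1 : 'M[R[i]]_N) = 1 by exact: invmx1.
  by rewrite !mulr1.
have h := mxbeta_rec (comm_addn2 k PQ) (@positive_stable_addn P k Pst) Qst.
have e : P + k%:R%:M + Q = P + Q + k%:R%:M by rewrite addrAC.
have e' : P + k%:R%:M + 1%:R%:M = P + k.+1%:R%:M.
  by rewrite -addrA -raddfD /= -natrD addn1.
rewrite e e' IH in h.
have DV : (P + Q + k%:R%:M) * invmx (P + Q + k%:R%:M) = 1 by exact: mulmxV.
have PD : GRing.comm (P + k%:R%:M) (P + Q).
  by apply: commrD; [exact/commr_sym/comm_addn|exact: comm_addn2].
have c1 := comm_invmx (comm_mxpoch k PD).
have c2 : GRing.comm (invmx (mxpoch (P + Q) k)) (invmx (P + Q + k%:R%:M)).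
  apply/comm_invmx/comm_addn/commr_sym/comm_invmx/comm_mxpoch.
  by [].
have r : mxpoch P k.+1 * invmx (mxpoch (P + Q) k.+1) = mxpoch P k *
    invmx (mxpoch (P + Q) k) * (P + k%:R%:M) * invmx (P + Q + k%:R%:M).
  rewrite !mxpochS (invmxM (mxpoch_unit k Du) (Du k)) -c2.
  move: (invmx (mxpoch _ _)) c1 (invmx (P + _ + _)) => D' c1 U'.
  by rewrite -(mulrA _ D') -c1 !mulrA.
have gen (b b' x p u u' y : 'M[R[i]]_N) :
    b * x * p = b' * u -> u * u' = 1 -> y = x * p * u' -> b' = b * y.
  by move=> h1 h2 ->; rewrite -[b']mulr1 -h2 !mulrA -h1.
exact: gen h DV r.
Qed.

End BetaRecursion.

(** * The fractional integral of 1F2 *)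

Section Hypergeometric.
Context {R : realType} {N : nat}.
Implicit Types (A B C P Q : 'M[R[i]]_N).

Definition hyp1F2_coef A B C k : 'M[R[i]]_N :=
  mxpoch A k * invmx (mxpoch B k) * invmx (mxpoch C k).

Definition hyp2F3_coef A P B C D k : 'M[R[i]]_N :=
  mxpoch A k * mxpoch P k * invmx (mxpoch B k) * invmx (mxpoch C k)
    * invmx (mxpoch D k).

Lemma hyp1F2_termE A B C (t : R) :
  hyp1F2_term A B C t%:C = expterm (hyp1F2_coef A B C) t.
Proof.
apply/funext => k; rewrite /hyp1F2_term /expterm rmorphM rmorphXn fmorphV.
by rewrite rmorph_nat.
Qed.

Lemma hyp2F3_termE A P B C D (t : R) :
  hyp2F3_term A P B C D t%:C = expterm (hyp2F3_coef A P B C D) t.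
Proof.
apply/funext => k; rewrite /hyp2F3_term /expterm rmorphM rmorphXn fmorphV.
by rewrite rmorph_nat.
Qed.

Lemma geom_bounded_hyp1F2 A B C : GRing.comm A B ->
  (forall s : nat, B + (s%:R)%:M \in unitmx) ->
  (forall s : nat, C + (s%:R)%:M \in unitmx) ->
  geom_bounded (hyp1F2_coef A B C).
Proof.
move=> AB Bu Cu; apply: geom_bounded_mul; first exact: geom_bounded_mxpoch_ratio.
exact: geom_bounded_invmx_mxpoch.
Qed.

Lemma geom_bounded_hyp2F3 A P B C D :
  GRing.comm A B -> GRing.comm P B -> GRing.comm P C ->
  (forall s : nat, B + (s%:R)%:M \in unitmx) ->
  (forall s : nat, C + (s%:R)%:M \in unitmx) ->
  (forall s : nat, D + (s%:R)%:M \in unitmx) ->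
  geom_bounded (hyp2F3_coef A P B C D).
Proof.
move=> AB PB PC Bu Cu Du.
have -> : hyp2F3_coef A P B C D = fun k => mxpoch A k * invmx (mxpoch B k) *
    (mxpoch P k * invmx (mxpoch C k)) * invmx (mxpoch D k).
  apply/funext => k; rewrite /hyp2F3_coef.
  have c : GRing.comm (mxpoch P k) (invmx (mxpoch B k)).
    by apply/comm_invmx/comm_mxpoch/commr_sym/comm_mxpoch/commr_sym.
  by rewrite -(mulrA (mxpoch A k)) c !mulrA.
apply: geom_bounded_mul; last exact: geom_bounded_invmx_mxpoch.
by apply: geom_bounded_mul; exact: geom_bounded_mxpoch_ratio.
Qed.

Lemma mxint_scale (x : R) (F : R -> 'M[R[i]]_N) V : 0 < x ->
  mxint 0 1 (fun u => x%:C *: F (x * u)) V -> mxint 0 x F V.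
Proof.
move=> x0 FV i j; have [h1 h2] := FV i j; split; apply: (rint_scale x0).
  by apply: (lin_eq h1) => // u; rewrite mxE cReM /= mul0r subr0.
by apply: (lin_eq h2) => // u; rewrite mxE cImM /= mul0r addr0.
Qed.

(** Integration term by term, each partial sum being dominated by a multiple of
    the weight; as t^k t^(P-I) = t^(P+kI-I), the integrals of the terms are values
    of the beta function at shifted arguments. *)
Lemma mxint_beta_expsum P Q (c : nat -> 'M[R[i]]_N) (x : R) :
  GRing.comm P Q -> positive_stable P -> positive_stable Q ->
  geom_bounded c -> 0 <= x ->
  exists V, mxint 0 1 (fun u => mxbeta_integrand P Q u * expsum c (x * u)) V /\
    mxcvgn (fun n => mxbeta P Q * series (expterm
      (fun k => mxpoch P k * invmx (mxpoch (P + Q) k) * c k) x) n) V.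
Proof.
move=> PQ Pst Qst cb x0.
have [K Kb] := expterm_series_bounded cb x0.
have [C [p [q [C0 p0 q0 bd]]]] := mxbeta_integrand_bound Pst Qst.
have K0 : 0 <= K.
  apply: le_trans (mxn_ge0 _) (Kb 0 0%N _); by rewrite normr0.
have termE u k : 0 < u -> mxbeta_integrand (P + k%:R%:M) Q u *
    ((x ^+ k / k`!%:R)%:C *: c k) = mxbeta_integrand P Q u * expterm c (x * u) k.
  move=> u0; rewrite (mxbeta_integrand_addn _ _ _ u0) /expterm.
  move: (mxbeta_integrand P Q u) => W.
  rewrite -mxscalerAl -!mxscalerAr scalerA -rmorphM exprMn.
  by congr (_%:C *: _); ring.
apply: (@mxint_dominated_cvg _ _ 0 1
  (fun n u => mxbeta_integrand P Q u * series (expterm c (x * u)) n) _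
  (fun u => C * K * beta_dominant p q u)).
- move=> n; rewrite /series /= mulr_sumr.
  apply: (@mxint_congr _ _ _ _ (fun u => \sum_(0 <= k < n)
      mxbeta_integrand (P + k%:R%:M) Q u * ((x ^+ k / k`!%:R)%:C *: c k))).
    move=> u /andP[u0 _]; rewrite (eq_bigr _ (fun k _ => termE u k u0)).
    by move: (mxbeta_integrand P Q u) => W; rewrite mulr_sumr.
  apply: (mxlift_sum (rint_linear 0 1)) => k.
  have -> : mxbeta P Q * expterm
      (fun k => mxpoch P k * invmx (mxpoch (P + Q) k) * c k) x k =
      mxbeta (P + k%:R%:M) Q * ((x ^+ k / k`!%:R)%:C *: c k).
    by rewrite /expterm mxbeta_addn// -!mxscalerAr !mulrA.
  have I := mxbeta_integrand_mxint (@positive_stable_addn R N P k Pst) Qst.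
  exact: (mxliftMr (rint_linear 0 1) _ I).
- move=> u u01; apply: (mxliftMl rcvgn_linear); exact: mxcvgn_expsum.
- exact: integrableZl _ (beta_dominant_integrable p0 q0).
- move=> n u u01; apply: le_trans (mxnM _ _) _; rewrite mulrAC.
  apply: ler_pM; rewrite ?mxn_ge0 ?bd//; apply: Kb.
  have /andP[u0 u1] := u01.
  rewrite ger0_norm; last by apply: mulr_ge0 => //; exact: ltW.
  by rewrite ler_piMr// ltW.
Qed.

(** After the substitution t = x u the weight splits into a power of x, in which
    the scalar x is the Jacobian, and the integrand of the beta function. *)
Lemma mxrpow_split P Q (x u : R) : GRing.comm P Q -> 0 < x -> 0 < u < 1 ->
  x%:C *: (mxrpow (x * u) (P - 1%:M) * mxrpow (x - x * u) (Q - 1%:M)) =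
  mxrpow x (P + Q - 1%:M) * mxbeta_integrand P Q u.
Proof.
move=> PQ x0 /andP[u0 u1]; have s0 : 0 < 1 - u by rewrite subr_gt0.
have PQ1 : GRing.comm (P - 1%:M) (Q - 1%:M).
  apply: commrB; last exact: comm_mx_scalar.
  by apply/commr_sym; apply: commrB; [exact: commr_sym|exact: comm_mx_scalar].
have -> : x - x * u = x * (1 - u) by rewrite mulrBr mulr1.
have e : P + Q - 1%:M = P - 1%:M + (Q - 1%:M) + 1%:R%:M.
  by rewrite addrA subrK addrAC.
rewrite !mxrpowM// e mxrpow_addn// expr1 (mxrpowD x PQ1).
have c : GRing.comm (mxrpow u (P - 1%:M)) (mxrpow x (Q - 1%:M)).
  by apply/commr_sym/mxrpow_comm/commr_sym/mxrpow_comm.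
rewrite -[mxbeta_integrand P Q u]/(mxrpow u (P - 1%:M) * mxrpow (1 - u) (Q - 1%:M)).
move: (mxrpow u _) (mxrpow x (Q - _)) c (mxrpow x _) (mxrpow (1 - u) _).
move=> a b ab p q; rewrite -mxscalerAl; congr (_ *: _).
by rewrite -!mulrA; congr (_ * _); rewrite !mulrA ab.
Qed.

Lemma hyp2F3_coefE A B C P D k : GRing.comm A P -> GRing.comm A D ->
  GRing.comm B D -> GRing.comm C D ->
  mxpoch P k * invmx (mxpoch D k) * hyp1F2_coef A B C k =
  hyp2F3_coef A P B C D k.
Proof.
move=> AP AD BD CD; rewrite /hyp1F2_coef /hyp2F3_coef.
have comm_poch (X Y : 'M[R[i]]_N) : GRing.comm X Y -> GRing.comm (mxpoch X k) (mxpoch Y k).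
  by move=> XY; exact/comm_mxpoch/commr_sym/comm_mxpoch/commr_sym.
have ap := comm_poch _ _ AP.
have ad := comm_invmx (comm_poch _ _ AD).
have bd : GRing.comm (invmx (mxpoch B k)) (invmx (mxpoch D k)).
  exact/comm_invmx/commr_sym/comm_invmx/commr_sym/comm_poch.
have cd : GRing.comm (invmx (mxpoch C k)) (invmx (mxpoch D k)).
  exact/comm_invmx/commr_sym/comm_invmx/commr_sym/comm_poch.
move: (mxpoch A k) (mxpoch P k) (invmx (mxpoch B k)) (invmx (mxpoch C k))
  (invmx (mxpoch D k)) ap ad bd cd => a p b c d ap ad bd cd.
by rewrite -!mulrA cd (mulrA b) bd -!mulrA (mulrA a p) ap -!mulrA
  (mulrA a d) ad -!mulrA.
Qed.

End Hypergeometric.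

Theorem theorem2p8 (R : realType) (N : nat) (A B C P Q : 'M[R[i]]_N)
    (hcomm : all2rel (@comm_mxb _ N) [:: A; B; C; P; Q])
    (hB : forall s : nat, B + (s%:R)%:M \in unitmx)
    (hC : forall s : nat, C + (s%:R)%:M \in unitmx)
    (hP : positive_stable P) (hQ : positive_stable Q)
    (x : R) (hx : 0 < x) :
  (* both sides are well defined *)
  [/\ forall t : R, 0 < t < x -> cvgn (series (hyp1F2_term A B C t%:C)),
      mxintegrable 0 x (fun t => mxrpow t (P - 1%:M)
        *m mxrpow (x - t) (Q - 1%:M) *m hyp1F2 A B C t%:C),
      mxintegrable 0 1 (mxbeta_integrand P Q),
      forall s : nat, P + Q + (s%:R)%:M \in unitmx
    & cvgn (series (hyp2F3_term A P B C (P + Q) x%:C))] /\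
  mxintegral 0 x (fun t => mxrpow t (P - 1%:M)
    *m mxrpow (x - t) (Q - 1%:M) *m hyp1F2 A B C t%:C)
  = mxrpow x (P + Q - 1%:M) *m mxbeta P Q *m hyp2F3 A P B C (P + Q) x%:C.
Proof.
have comm X Y : X \in [:: A; B; C; P; Q] -> Y \in [:: A; B; C; P; Q] ->
    GRing.comm X Y.
  by move=> hX hY; have /eqP := allrelP hcomm X Y hX hY.
have AB : GRing.comm A B by apply: comm; rewrite !inE eqxx ?orbT.
have AP : GRing.comm A P by apply: comm; rewrite !inE eqxx ?orbT.
have AQ : GRing.comm A Q by apply: comm; rewrite !inE eqxx ?orbT.
have PB : GRing.comm P B by apply: comm; rewrite !inE eqxx ?orbT.
have QB : GRing.comm Q B by apply: comm; rewrite !inE eqxx ?orbT.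
have PC : GRing.comm P C by apply: comm; rewrite !inE eqxx ?orbT.
have QC : GRing.comm Q C by apply: comm; rewrite !inE eqxx ?orbT.
have PQ : GRing.comm P Q by apply: comm; rewrite !inE eqxx ?orbT.
have Du s := positive_stableD_addn_unit s PQ hP hQ.
have cb := geom_bounded_hyp1F2 AB hB hC.
have db := geom_bounded_hyp2F3 AB PB PC hB hC Du.
have F1E t : hyp1F2 A B C t%:C = expsum (hyp1F2_coef A B C) t.
  by rewrite /hyp1F2 hyp1F2_termE.
have F2E : hyp2F3 A P B C (P + Q) x%:C = expsum (hyp2F3_coef A P B C (P + Q)) x.
  by rewrite /hyp2F3 hyp2F3_termE.
have [V [V1 V2]] := mxint_beta_expsum PQ hP hQ cb (ltW hx).
have VE : V = mxbeta P Q * hyp2F3 A P B C (P + Q) x%:C.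
  apply: mxcvgn_unique V2 _; rewrite F2E.
  apply: (mxliftMl rcvgn_linear).
  have -> : (fun k => mxpoch P k * invmx (mxpoch (P + Q) k) * hyp1F2_coef A B C k)
      = hyp2F3_coef A P B C (P + Q).
    apply/funext => k; apply: hyp2F3_coefE => //; apply: commrD => //;
      exact: commr_sym.
  exact: mxcvgn_expsum.
pose Z := mxrpow x (P + Q - 1%:M).
have I : mxint 0 x (fun t => mxrpow t (P - 1%:M)
    *m mxrpow (x - t) (Q - 1%:M) *m hyp1F2 A B C t%:C) (Z * V).
  apply: mxint_scale => //.
  apply: mxint_congr (mxliftMl (rint_linear 0 1) Z V1) => u u01.
  rewrite F1E mulrA -(mxrpow_split PQ hx u01).
  exact: esym (mxscalerAl _ _ _).
have [Ii Iv] := (mxintP _ _ _ _).1 I.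
have [Bi _] := (mxintP _ _ _ _).1 (mxbeta_integrand_mxint hP hQ).
split; last by rewrite Iv VE; exact: mulrA.
split => //.
- move=> t _; rewrite hyp1F2_termE; apply: cvgP; apply: mxcvgnP.
  exact: mxcvgn_expsum.
- rewrite hyp2F3_termE; apply: cvgP; apply: mxcvgnP.
  exact: mxcvgn_expsum.
Qed.
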